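(* Let $K$ be a field of characteristic $p>0$, let $A=K[[Y]]$ be the power series ring in one variable over $K$, and let $Q(A)$ be the field of fractions of $A$. Let $R=A[X_1,\ldots,X_n]$ be the standard $\mathbb{N}^n$-graded polynomial ring over $A$, i.e., $\deg(A)=\underline{0}\in\mathbb{N}^n$ and $\deg(X_j)=e_j\in\mathbb{N}^n$ for $j=1,\ldots,n$. Let $M=\bigoplus_{\underline{u}\in\mathbb{Z}^n}M_{\underline{u}}$ be a $\mathbb{Z}^n$-graded $\mathcal{F}$-finite $\mathcal{F}$-module over $R$. For each $\underline{u}\in\mathbb{Z}^n$ let $a(\underline{u}),b(\underline{u}),c(\underline{u})\geq 0$ be the finite numbers such that $$M_{\underline{u}}\cong E(A/YA)^{a(\underline{u})}\oplus Q(A)^{b(\underline{u})}\oplus A^{c(\underline{u})}$$ as $A$-modules, where $E(A/YA)$ denotes the injective hull of $A/YA$ as an $A$-module. Then for each subset $U\subseteq\{1,\ldots,n\}$, each of the functions $\underline{u}\mapsto a(\underline{u})$, $\underline{u}\mapsto b(\underline{u})$ and $\underline{u}\mapsto c(\underline{u})$ is constant on $\mathcal{B}(U)=\{\underline{u}\in\mathbb{Z}^n\mid u_i\geq 0\text{ if }i\in U\text{ and }u_i\leq -1\text{ if }i\notin U\}$.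
   Context: Here $e_j$ is the $j$-th standard basis vector of $\mathbb{Z}^n$. In this setting every graded component $M_{\underline{u}}$ is known to admit a decomposition of the stated form with $a(\underline{u}),b(\underline{u}),c(\underline{u})$ non-negative integers. For a regular Noetherian ring $R$ of characteristic $p>0$, let $R^1$ be the $(R,R)$-bimodule which is $R$ as an additive group, with the usual left multiplication and with right multiplication through the Frobenius map $a\mapsto a^p$. The Frobenius functor is $\mathcal{F}(M)=R^1\otimes_R M$ on $R$-modules, with $\mathcal{F}(f)=\mathrm{id}\otimes f$; $\mathcal{F}^e$ denotes its $e$-th iterate. An $\mathcal{F}$-module over $R$ is an $R$-module $M$ with an $R$-module isomorphism $\theta:M\to\mathcal{F}(M)$. An $\mathcal{F}$-module is $\mathcal{F}$-finite if it is of the form $M=\varinjlim\left(U\xrightarrow{\beta}\mathcal{F}(U)\xrightarrow{\mathcal{F}(\beta)}\mathcal{F}^2(U)\to\cdots\right)$ for a finitely generated $R$-module $U$ and an $R$-linear map $\beta:U\to\mathcal{F}(U)$ (a generating morphism), with the structure isomorphism $M\cong\mathcal{F}(M)$ induced by shifting the direct system. If $R$ is $\mathbb{Z}^n$-graded and $M$ is a $\mathbb{Z}^n$-graded $R$-module, then $\mathcal{F}(M)$ is $\mathbb{Z}^n$-graded by $\deg(r\otimes m)=\deg(r)+p\deg(m)$ for homogeneous $r\in R$, $m\in M$. A $\mathbb{Z}^n$-graded $\mathcal{F}$-finite $\mathcal{F}$-module is one arising as such a direct limit with the finitely generated module graded and $\beta$ degree preserving, with the induced grading on $M$. *)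

(* Defs.v *)
From HB Require Import structures.
From mathcomp Require Import all_boot all_order all_algebra.
From mathcomp Require Import boolp freeg mpoly.

Set Implicit Arguments.
Unset Strict Implicit.
Unset Printing Implicit Defensive.

Import Order.TTheory GRing.Theory Num.Theory.
Local Open Scope ring_scope.
Local Open Scope quotient_scope.

(* K[[Y]]: [fcoef a i] is the coefficient of Y^i. *)
Record fps (K : fieldType) : Type := Fps { fcoef : nat -> K }.

Section PowerSeries.
Variable K : fieldType.
Implicit Types a b c : fps K.

HB.instance Definition _ := gen_eqMixin (fps K).
HB.instance Definition _ := gen_choiceMixin (fps K).

Lemma fpsP a b : (forall i, fcoef a i = fcoef b i) -> a = b.
Proof. by case: a b => [f] [g] /= /funext ->. Qed.

Definition fps_zero : fps K := Fps (fun=> 0).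
Definition fps_one : fps K := Fps (fun i => (i == 0%N)%:R).
Definition fps_opp a : fps K := Fps (fun i => - fcoef a i).
Definition fps_add a b : fps K := Fps (fun i => fcoef a i + fcoef b i).
Definition fps_mul a b : fps K :=
  Fps (fun i => \sum_(j < i.+1) fcoef a j * fcoef b (i - j)).

Fact fps_addA : associative fps_add.
Proof. by move=> a b c; apply: fpsP => i /=; rewrite addrA. Qed.
Fact fps_addC : commutative fps_add.
Proof. by move=> a b; apply: fpsP => i /=; rewrite addrC. Qed.
Fact fps_add0 : left_id fps_zero fps_add.
Proof. by move=> a; apply: fpsP => i /=; rewrite add0r. Qed.
Fact fps_addN : left_inverse fps_zero fps_opp fps_add.
Proof. by move=> a; apply: fpsP => i /=; rewrite addNr. Qed.

HB.instance Definition _ :=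
  GRing.isZmodule.Build (fps K) fps_addA fps_addC fps_add0 fps_addN.

Definition fps_trunc m a : {poly K} := \poly_(i < m) fcoef a i.

Lemma fps_mul_trunc m a b i : (i < m)%N ->
  fcoef (fps_mul a b) i = (fps_trunc m a * fps_trunc m b)`_i.
Proof.
move=> lt_im; rewrite coefM; apply: eq_bigr => j _.
rewrite !coef_poly (leq_ltn_trans (leq_subr _ _) lt_im).
by rewrite (leq_ltn_trans _ lt_im) // -ltnS.
Qed.

Lemma coefM_eq (P P' Q Q' : {poly K}) i :
    (forall j, (j <= i)%N -> P`_j = P'`_j) ->
    (forall j, (j <= i)%N -> Q`_j = Q'`_j) ->
  (P * Q)`_i = (P' * Q')`_i.
Proof.
move=> eP eQ; rewrite !coefM; apply: eq_bigr => j _.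
by rewrite eP ?eQ ?leq_subr // -ltnS.
Qed.

Lemma fps_truncM m a b i : (i < m)%N ->
  (fps_trunc m (fps_mul a b))`_i = (fps_trunc m a * fps_trunc m b)`_i.
Proof. by move=> lt_im; rewrite coef_poly lt_im (fps_mul_trunc _ _ lt_im). Qed.

Fact fps_mulA : associative fps_mul.
Proof.
move=> a b c; apply: fpsP => i; rewrite !(@fps_mul_trunc i.+1) //.
transitivity (fps_trunc i.+1 a * (fps_trunc i.+1 b * fps_trunc i.+1 c))`_i.
  by apply: coefM_eq => // j ji; apply: fps_truncM.
rewrite mulrA; apply: coefM_eq => // j ji.
by rewrite fps_truncM.
Qed.

Fact fps_mulC : commutative fps_mul.
Proof.
by move=> a b; apply: fpsP => i; rewrite !(@fps_mul_trunc i.+1) // mulrC.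
Qed.

Fact fps_mul1 : left_id fps_one fps_mul.
Proof.
move=> a; apply: fpsP => i /=.
rewrite big_ord_recl /= mul1r subn0 big1 ?addr0 // => j _.
by rewrite mul0r.
Qed.

Fact fps_mulDl : left_distributive fps_mul fps_add.
Proof.
move=> a b c; apply: fpsP => i /=.
by rewrite -big_split; apply: eq_bigr => j _; rewrite mulrDl.
Qed.

Fact fps_one_neq0 : fps_one != 0.
Proof.
by apply/eqP => /(congr1 (fun a : fps K => fcoef a 0)) /eqP; rewrite /= oner_eq0.
Qed.

HB.instance Definition _ := GRing.Zmodule_isComNzRing.Build (fps K)
  fps_mulA fps_mulC fps_mul1 fps_mulDl fps_one_neq0.

Definition fps_unit : {pred fps K} := fun a => fcoef a 0 != 0.

Fixpoint fps_inv_seq a m : seq K :=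
  if m is m'.+1 then
    let s := fps_inv_seq a m' in
    rcons s ((fcoef a 0)^-1 *
             ((m' == 0%N)%:R - \sum_(i < m') fcoef a (m' - i) * s`_i))
  else [::].

Definition fps_inv a : fps K :=
  if fps_unit a then Fps (fun m => (fps_inv_seq a m.+1)`_m) else a.

Lemma size_fps_inv_seq a m : size (fps_inv_seq a m) = m.
Proof. by elim: m => //= m IH; rewrite size_rcons IH. Qed.

Lemma nth_fps_inv_seq a m i : (i < m)%N ->
  (fps_inv_seq a m)`_i = (fps_inv_seq a i.+1)`_i.
Proof.
elim: m => // m IH; rewrite ltnS leq_eqVlt => /orP[/eqP -> //|lt_im].
by rewrite -(IH lt_im) /= nth_rcons size_fps_inv_seq lt_im.
Qed.

Fact fps_mulV : {in fps_unit, left_inverse 1 fps_inv *%R}.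
Proof.
move=> a; rewrite unfold_in => ua; apply: fpsP => i.
rewrite /fps_inv /fps_unit ua /= big_ord_recr subnn /= nth_rcons size_fps_inv_seq.
rewrite ltnn eqxx mulrC mulrA divff // mul1r addrC -[RHS]addr0 -addrA; congr (_ + _).
apply/eqP; rewrite addrC subr_eq0; apply/eqP; apply: eq_bigr => j _.
by rewrite mulrC; congr (_ * _); rewrite (nth_fps_inv_seq a (ltn_ord j)).
Qed.

Fact fps_unitP a b : b * a = 1 -> fps_unit a.
Proof.
move=> /(congr1 (fun a => fcoef a 0)) /=; rewrite big_ord1 /= => h.
apply/eqP => a0; move: h; rewrite /= subn0 a0 mulr0 => /esym /eqP.
by rewrite oner_eq0.
Qed.

Fact fps_inv_out : {in [predC fps_unit], fps_inv =1 id}.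
Proof. by move=> a ua; rewrite /fps_inv ifN. Qed.

HB.instance Definition _ := GRing.ComNzRing_hasMulInverse.Build (fps K)
  fps_mulV fps_unitP fps_inv_out.

Lemma fps_neq0_order a : a != 0 ->
  exists2 m, fcoef a m != 0 & forall i, (i < m)%N -> fcoef a i = 0.
Proof.
move=> a_neq0; have exm : exists m, fcoef a m != 0.
  apply: contrapT => /forallNP h; case/eqP: a_neq0; apply: fpsP => i.
  by apply/eqP/negPn/negP/h.
exists (ex_minn exm); case: ex_minnP => m // _ minm i.
by apply: contraTeq => /minm; rewrite -leqNgt.
Qed.

Fact fps_idomain a b : a * b = 0 -> (a == 0) || (b == 0).
Proof.
move=> ab0; apply/negPn/negP; rewrite negb_or => /andP[].
move=> /fps_neq0_order[m am mina] /fps_neq0_order[k bk minb].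
move: ab0 => /(congr1 (fun a => fcoef a (m + k)%N)) /=.
have mlt : (m < (m + k).+1)%N by rewrite ltnS leq_addr.
rewrite (bigD1 (Ordinal mlt)) //= addKn big1 ?addr0.
  by move/eqP; rewrite mulf_eq0 (negbTE am) (negbTE bk).
move=> j; rewrite -val_eqE /= neq_ltn => /orP[/mina -> | gtj].
  by rewrite mul0r.
by rewrite (minb (m + k - j)%N) ?mulr0 // ltn_subLR ?ltn_add2r // -ltnS.
Qed.

HB.instance Definition _ := GRing.ComUnitRing_isIntegral.Build (fps K)
  fps_idomain.

Definition fpsY : fps K := Fps (fun i => (i == 1%N)%:R).

End PowerSeries.

Section LinearQuotient.
Variables (R : pzRingType) (V : lmodType R).

Inductive generated (S : V -> Prop) : V -> Prop :=
| generated0 : generated S 0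
| generatedD a x y : S x -> generated S y -> generated S (a *: x + y).

Definition gen_submod (S : V -> Prop) : {pred V} := fun x => `[< generated S x >].

Variable S : V -> Prop.

Lemma gen_submodP x : reflect (generated S x) (x \in gen_submod S).
Proof. exact: asboolP. Qed.

Lemma generated_linear a x y :
  generated S x -> generated S y -> generated S (a *: x + y).
Proof.
move=> Sx Sy; elim: Sx => [|b z t Sz _ IH]; first by rewrite scaler0 add0r.
by rewrite scalerDr scalerA -addrA; apply: generatedD.
Qed.

Fact gen_submod_zmod_closed : zmod_closed (gen_submod S).
Proof.
split=> [|x y /gen_submodP Sx /gen_submodP Sy]; apply/gen_submodP.
  exact: generated0.
by rewrite addrC -scaleN1r; apply: generated_linear.
Qed.

HB.instance Definition _ :=
  GRing.isZmodClosed.Build V (gen_submod S) gen_submod_zmod_closed.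

Definition lquot := Quotient.quot (gen_submod S : zmodClosed V).

HB.instance Definition _ := Choice.on lquot.
HB.instance Definition _ := GRing.Zmodule.on lquot.

Definition lquot_pi (x : V) : lquot := \pi_(Quotient.quot (gen_submod S : zmodClosed V)) x.

Lemma lquot_piE x y : lquot_pi x = lquot_pi y <-> generated S (x - y).
Proof.
rewrite /lquot_pi; split => [/eqP|h]; last apply/eqP.
  by rewrite -Quotient.idealrBE => /gen_submodP.
by rewrite -Quotient.idealrBE; apply/gen_submodP.
Qed.

Lemma lquot_repr (q : lquot) : lquot_pi (repr q) = q.
Proof. exact: reprK. Qed.

Fact lquot_pi_zmod_morphism : zmod_morphism lquot_pi.
Proof. by move=> x y; rewrite /lquot_pi !piE. Qed.

Definition lquot_scale a (q : lquot) : lquot := lquot_pi (a *: repr q).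

Lemma lquot_scale_pi a x : lquot_scale a (lquot_pi x) = lquot_pi (a *: x).
Proof.
apply/lquot_piE; rewrite -scalerBr -[_ *: _]addr0; apply: generated_linear.
  by apply/lquot_piE; rewrite lquot_repr.
exact: generated0.
Qed.

HB.instance Definition _ :=
  GRing.isZmodMorphism.Build V lquot lquot_pi lquot_pi_zmod_morphism.

Fact lquot_scaleA a b q : lquot_scale a (lquot_scale b q) = lquot_scale (a * b) q.
Proof. by rewrite -[q]lquot_repr !lquot_scale_pi scalerA. Qed.
Fact lquot_scale1 : left_id 1 lquot_scale.
Proof. by move=> q; rewrite -[q]lquot_repr !lquot_scale_pi scale1r. Qed.
Fact lquot_scaleDr : right_distributive lquot_scale +%R.
Proof.
move=> a q r; rewrite -[q]lquot_repr -[r]lquot_repr -raddfD !lquot_scale_pi.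
by rewrite scalerDr raddfD.
Qed.
Fact lquot_scaleDl q : {morph lquot_scale^~ q : a b / a + b}.
Proof. by move=> a b; rewrite -[q]lquot_repr !lquot_scale_pi scalerDl raddfD. Qed.

HB.instance Definition _ := GRing.Zmodule_isLmodule.Build R lquot
  lquot_scaleA lquot_scale1 lquot_scaleDr lquot_scaleDl.

Fact lquot_pi_scalable : scalable lquot_pi.
Proof. by move=> a x; rewrite -lquot_scale_pi. Qed.

HB.instance Definition _ :=
  GRing.isScalable.Build R V lquot *:%R lquot_pi lquot_pi_scalable.

(* [lquot_lift g q] is the linear map induced by [g] when [g] vanishes on [S]. *)
Definition lquot_lift (W : lmodType R) (g : V -> W) (q : lquot) : W := g (repr q).

Section Lift.
Variables (W : lmodType R) (g : {linear V -> W}).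
Hypothesis g0 : forall x, S x -> g x = 0.

Lemma lquot_lift_pi x : lquot_lift g (lquot_pi x) = g x.
Proof.
apply/eqP; rewrite -subr_eq0 -linearB; apply/eqP.
have : generated S (repr (lquot_pi x) - x) by apply/lquot_piE; rewrite lquot_repr.
elim=> [|a y z Sy _ IH]; first by rewrite linear0.
by rewrite linearP IH g0 // scaler0 addr0.
Qed.

Lemma lquot_lift_linear : linear (lquot_lift g).
Proof.
move=> a q r; rewrite -[q]lquot_repr -[r]lquot_repr -linearP !lquot_lift_pi.
exact: linearP.
Qed.
End Lift.

End LinearQuotient.

Section FreeModule.
Variables (R : comNzRingType) (T : choiceType).

(* The free module {freeg T / R}, with its scaling re-declared over R as a
   comNzRingType, so that later structures are inferred along a single path. *)
Definition freemod : Type := {freeg T / R}.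
HB.instance Definition _ := GRing.Zmodule.on freemod.
HB.instance Definition _ := GRing.Zmodule_isLmodule.Build R freemod
  (@fgscaleA R T) (@fgscale1r R T) (@fgscaleDr R T) (@fgscaleDl R T).

Definition fgen (t : T) : freemod := << t >>.

Definition freemod_lift_fun (M : lmodType R) (f : T -> M) : freemod -> M := fglift f.

Variables (M : lmodType R) (f : T -> M).

Fact freemod_lift_zmod_morphism : zmod_morphism (freemod_lift_fun f).
Proof. exact: lift_is_additive. Qed.

HB.instance Definition _ := GRing.isZmodMorphism.Build freemod M
  (freemod_lift_fun f) freemod_lift_zmod_morphism.

Fact freemod_lift_scalable : scalable (freemod_lift_fun f).
Proof.
move=> a x; have liftE c t : freemod_lift_fun f << c *g t >> = c *: f t by exact: liftU.
have -> : freemod_lift_fun f x =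
    freemod_lift_fun f (\sum_(z <- dom x) << coeff z x *g z >> : freemod).
  by rewrite freeg_sumE.
rewrite [a *: x]/(fgscale a x) /fgscale !raddf_sum.
by apply: eq_bigr => t _; rewrite /= !liftE scalerA.
Qed.

HB.instance Definition _ := GRing.isScalable.Build R freemod M *:%R
  (freemod_lift_fun f) freemod_lift_scalable.

Definition freemod_lift : {linear freemod -> M} := freemod_lift_fun f.

Lemma freemod_liftE t : freemod_lift (fgen t) = f t.
Proof. by rewrite -[RHS]scale1r; apply: liftU. Qed.

End FreeModule.

Section Frobenius.
Variables (R : comNzRingType) (p : nat).

(* Relations presenting the tensor product of R^1 with M, as a left R-module, on
   the generators (x, m), with x in R^1: biadditivity, balancedness for the right
   action x . a = x * a ^+ p of R on R^1, and the left action of R on R^1. *)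
Inductive frob_rel (M : lmodType R) : freemod R (R * M)%type -> Prop :=
| frob_rel_addl x y m : frob_rel (fgen R (x + y, m) - fgen R (x, m) - fgen R (y, m))
| frob_rel_addr x m k : frob_rel (fgen R (x, m + k) - fgen R (x, m) - fgen R (x, k))
| frob_rel_bal x a m : frob_rel (fgen R (x * a ^+ p, m) - fgen R (x, a *: m))
| frob_rel_scale a x m : frob_rel (fgen R (a * x, m) - a *: fgen R (x, m)).

Definition Frob (M : lmodType R) : Type := lquot (@frob_rel M).
HB.instance Definition _ (M : lmodType R) := GRing.Lmodule.copy (Frob M) (lquot (@frob_rel M)).

Definition ftensor (M : lmodType R) (x : R) (m : M) : Frob M :=
  lquot_pi (@frob_rel M) (fgen R (x, m)).

Section Map.
Variables (M N : lmodType R) (f : {linear M -> N}).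

Definition Frob_map_fun : Frob M -> Frob N :=
  @lquot_lift _ _ (@frob_rel M) _ (freemod_lift (fun xm : R * M => ftensor xm.1 (f xm.2))).

Lemma ftensor_addl (x y : R) (m : N) : ftensor (x + y) m = ftensor x m + ftensor y m.
Proof.
rewrite -raddfD; apply/lquot_piE; rewrite -[_ - _]addr0 -[_ - _]scale1r opprD addrA.
by apply: generatedD (generated0 _); apply: frob_rel_addl.
Qed.
Lemma ftensor_addr (x : R) (m k : N) : ftensor x (m + k) = ftensor x m + ftensor x k.
Proof.
rewrite -raddfD; apply/lquot_piE; rewrite -[_ - _]addr0 -[_ - _]scale1r opprD addrA.
by apply: generatedD (generated0 _); apply: frob_rel_addr.
Qed.
Lemma ftensor_bal (x a : R) (m : N) : ftensor (x * a ^+ p) m = ftensor x (a *: m).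
Proof.
apply/lquot_piE; rewrite -[_ - _]addr0 -[_ - _]scale1r.
by apply: generatedD (generated0 _); apply: frob_rel_bal.
Qed.
Lemma ftensor_scale (a x : R) (m : N) : ftensor (a * x) m = a *: ftensor x m.
Proof.
rewrite -linearZ; apply/lquot_piE; rewrite -[_ - _]addr0 -[_ - _]scale1r.
by apply: generatedD (generated0 _); apply: frob_rel_scale.
Qed.

Lemma Frob_map_rel t : frob_rel t ->
  freemod_lift (fun xm : R * M => ftensor xm.1 (f xm.2)) t = 0.
Proof.
case=> [x y m|x m k|x a m|a x m].
- by rewrite !linearB !freemod_liftE ftensor_addl [_ + ftensor y _]addrC addrK subrr.
- rewrite !linearB !freemod_liftE linearD ftensor_addr.
  by rewrite [_ + ftensor x (f k)]addrC addrK subrr.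
- by rewrite linearB !freemod_liftE linearZ ftensor_bal subrr.
- by rewrite linearB linearZ !freemod_liftE ftensor_scale subrr.
Qed.

HB.instance Definition _ := GRing.isLinear.Build R (Frob M) (Frob N) *:%R
  Frob_map_fun (lquot_lift_linear Frob_map_rel).

Definition Frob_map : {linear Frob M -> Frob N} := Frob_map_fun.

Lemma Frob_mapE x m : Frob_map (ftensor x m) = ftensor x (f m).
Proof.
by rewrite /= /Frob_map_fun lquot_lift_pi ?freemod_liftE //; apply: Frob_map_rel.
Qed.
End Map.

Fixpoint Frob_iter (M : lmodType R) (e : nat) : lmodType R :=
  if e is e'.+1 then Frob (Frob_iter M e') else M.

Fixpoint Frob_iter_map (M : lmodType R) (beta : {linear M -> Frob M}) (e : nat) :
    {linear Frob_iter M e -> Frob_iter M e.+1} :=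
  if e is e'.+1 then Frob_map (Frob_iter_map beta e') else beta.

End Frobenius.

Section Modules.
Variable R : nzRingType.

(* (L, phi) is a colimit of V 0 -> V 1 -> V 2 -> ... in R-modules, by the universal
   property; the last clause is uniqueness of the induced map. *)
Definition is_direct_limit (V : nat -> lmodType R)
    (f : forall e, {linear V e -> V e.+1})
    (L : lmodType R) (phi : forall e, {linear V e -> L}) : Prop :=
  (forall e x, phi e.+1 (f e x) = phi e x) /\
  forall (N : lmodType R) (psi : forall e, {linear V e -> N}),
    (forall e x, psi e.+1 (f e x) = psi e x) ->
    (exists h : {linear L -> N}, forall e x, h (phi e x) = psi e x) /\
    (forall h h' : {linear L -> N},
       (forall e x, h (phi e x) = psi e x) ->
       (forall e x, h' (phi e x) = psi e x) -> h =1 h').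

Definition finitely_generated (V : lmodType R) : Prop :=
  exists (k : nat) (g : 'I_k -> V),
    forall x : V, exists r : 'I_k -> R, x = \sum_(i < k) r i *: g i.

Definition injective_module (E : lmodType R) : Prop :=
  forall (N N' : lmodType R) (i : {linear N -> N'}) (f : {linear N -> E}),
    injective i -> exists g : {linear N' -> E}, forall x, g (i x) = f x.

Definition is_submodule (V : lmodType R) (S : V -> Prop) : Prop :=
  S 0 /\ forall a x y, S x -> S y -> S (a *: x + y).

Definition essential (N E : lmodType R) (i : {linear N -> E}) : Prop :=
  forall S : E -> Prop, is_submodule S ->
    (exists2 x, S x & x != 0) -> exists2 y : N, S (i y) & i y != 0.

Definition injective_hull (N E : lmodType R) (i : {linear N -> E}) : Prop :=
  [/\ injective_module E, injective i & essential i].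

End Modules.

(* A/YA for A = K[[Y]], as an A-module: A modulo the submodule generated by Y. *)
Definition residue_mod (K : fieldType) : lmodType (fps K) :=
  lquot (fun x : (fps K)^o => x = fpsY K).

(* Alias of the fraction field of A carrying its A-module structure. *)
Definition fracmod (A : idomainType) : Type := {fraction A}.

Section FracModule.
Variable A : idomainType.
HB.instance Definition _ := GRing.Zmodule.on (fracmod A).

Definition frac_scale (a : A) (q : fracmod A) : fracmod A :=
  tofrac a * (q : {fraction A}).

Fact frac_scaleA a b q : frac_scale a (frac_scale b q) = frac_scale (a * b) q.
Proof. by rewrite /frac_scale mulrA -tofracM. Qed.
Fact frac_scale1 : left_id 1 frac_scale.
Proof. by move=> q; rewrite /frac_scale tofrac1 mul1r. Qed.
Fact frac_scaleDr : right_distributive frac_scale +%R.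
Proof. by move=> a q r; rewrite /frac_scale mulrDr. Qed.
Fact frac_scaleDl q : {morph frac_scale^~ q : a b / a + b}.
Proof. by move=> a b; rewrite /frac_scale tofracD mulrDl. Qed.

HB.instance Definition _ := GRing.Zmodule_isLmodule.Build A (fracmod A)
  frac_scaleA frac_scale1 frac_scaleDr frac_scaleDl.
End FracModule.

Notation mdegree n := {ffun 'I_n -> int}.

Section Graded.
Variables (n : nat) (A : comNzRingType).
Local Notation R := {mpoly A[n]}.
Implicit Types u v w : mdegree n.

Definition multideg (m : 'X_{1..n}) : mdegree n := [ffun i => (m i)%:Z].

(* [r] is homogeneous of degree [u] (0 is homogeneous of every degree). *)
Definition mhomog u (r : R) : Prop := forall m, m \in msupp r -> multideg m = u.

(* [M] is the internal direct sum of its subgroups [gr u], compatibly with the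
   action of the homogeneous elements of R. *)
Definition is_grading (M : lmodType R) (gr : mdegree n -> M -> Prop) : Prop :=
  [/\ forall u, gr u 0 /\ (forall x y, gr u x -> gr u y -> gr u (x - y)),
      forall u v r x, mhomog v r -> gr u x -> gr (v + u) (r *: x),
      forall x, exists (s : seq (mdegree n)) (f : mdegree n -> M),
        (forall u, gr u (f u)) /\ x = \sum_(u <- s) f u
    & forall (s : seq (mdegree n)) (f : mdegree n -> M), uniq s ->
        (forall u, gr u (f u)) -> \sum_(u <- s) f u = 0 ->
        forall u, u \in s -> f u = 0].

Variable p : nat.

(* Sums of tensors of homogeneous elements, deg (r (x) m) = deg r + p deg m. *)
Definition Frob_grading (M : lmodType R) (gr : mdegree n -> M -> Prop)
    (u : mdegree n) (t : Frob p M) : Prop :=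
  exists (k : nat) (r : 'I_k -> R) (m : 'I_k -> M) (v w : 'I_k -> mdegree n),
    (forall i, [/\ mhomog (v i) (r i), gr (w i) (m i) & v i + w i *+ p = u]) /\
    t = \sum_(i < k) ftensor p (r i) (m i).

Fixpoint Frob_iter_grading (M : lmodType R) (gr : mdegree n -> M -> Prop) (e : nat) :
    mdegree n -> Frob_iter p M e -> Prop :=
  if e is e'.+1 then @Frob_grading (Frob_iter p M e') (@Frob_iter_grading M gr e')
  else gr.

(* The F-module (M, theta) with the family [gr] is the direct limit of the system
   generated by a degree preserving beta : V -> F(V), with V graded and finitely
   generated, and carries the structure map and the grading of that limit. *)
Definition graded_F_finite (M : lmodType R) (theta : {linear M -> Frob p M})
    (gr : mdegree n -> M -> Prop) : Prop :=
  exists (V : lmodType R) (grV : mdegree n -> V -> Prop)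
         (beta : {linear V -> Frob p V})
         (phi : forall e, {linear Frob_iter p V e -> M}),
    [/\ finitely_generated V /\ is_grading grV,
        forall u x, grV u x -> Frob_grading grV u (beta x),
        is_direct_limit (Frob_iter_map beta) phi,
        forall e (y : Frob p (Frob_iter p V e)),
          theta (phi e.+1 y) = Frob_map p (phi e) y
      & forall u m, gr u m <->
          exists e x, @Frob_iter_grading V grV e u x /\ phi e x = m].

End Graded.

(* The subset [Mu] of [M] is an [A]-submodule (for the restriction of scalars along
   A -> A[X_1, ..., X_n]) isomorphic to E^a (+) Q(A)^b (+) A^c. *)
Definition component_iso (n : nat) (A : idomainType) (M : lmodType {mpoly A[n]})
    (Mu : M -> Prop) (E : lmodType A) (a b c : nat) : Prop :=
  exists f : ({ffun 'I_a -> E} * {ffun 'I_b -> fracmod A} * {ffun 'I_c -> A^o})%type -> M,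
    [/\ forall (k : A) x y, f (k *: x + y) = k%:MP_[n] *: f x + f y,
        injective f
      & forall m, Mu m <-> exists x, f x = m].

Definition block (n : nat) (U : {set 'I_n}) (u : mdegree n) : Prop :=
  forall i : 'I_n, if i \in U then 0 <= u i else u i <= -1.

Definition constant_on (T T' : Type) (B : T -> Prop) (f : T -> T') : Prop :=
  forall u v, B u -> B v -> f u = f v.

(* Main.v *)
Require Import Defs.
From HB Require Import structures.
From mathcomp Require Import all_boot all_order all_algebra.
From mathcomp Require Import boolp freeg mpoly.

Set Implicit Arguments.
Unset Strict Implicit.
Unset Printing Implicit Defensive.

Import Order.TTheory GRing.Theory Num.Theory.
Local Open Scope ring_scope.

(** Write [A = K[[Y]]] and [R = A[X_1, ..., X_n]].  The multiplicities are
constant on blocks because the isomorphism [M = F(M)] relates the component of degree [u] to the one of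
degree [w = floor (u / p)], taken coordinatewise, and iterating this floor
division drives every degree of a block to a single corner of it.

Since the exponents of a monomial can be divided by [p] with remainder,
[R^1 (x)_R M] is the direct sum over reduced exponents [alpha] (all entries below
[p]) of [X^alpha A^1 (x)_A M].  In degree [u = alpha + p w] this leaves only
[X^alpha (A^1 (x)_A M_w)], so [M_u], which [theta] identifies with the degree [u]
part of [F(M)], is the Frobenius pullback over [A] of [M_w]
([structure_map_graded], [Frob_component_iso]).

The three summands [E], [Q(A)] and [A] are isomorphic to their own
Frobenius pullbacks.  To avoid tensor products over [A], a pullback is recognised
by a universal property of a semilinear endomorphism ([frob_model]); it passes to
finite direct sums, and each summand has it because it is a directed union of
cyclic modules ([locally_cyclic_model]).  Hence
[E^a (+) Q(A)^b (+) A^c], with exponents taken at [w], is also isomorphic to [M_u].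

The exponents are invariants of the module ([sum_mod_uniq]): [a] is the dimension
of the kernel of [Y], [c] that of its cokernel, and [b + c] is the rank.  So
[a], [b], [c] take the same values at [u] and at [floor (u / p)]
([multiplicities_deg_div]).  Under the floor division a nonnegative integer
descends to [0] and a negative one climbs to [-1] ([block_constant]), which gives
the theorem. *)

(** * Additive maps on formal sums *)

Lemma big_uniq_sub (T : eqType) (W : zmodType) (F : T -> W) (s t : seq T) :
  uniq s -> uniq t -> {subset s <= t} -> (forall z, z \notin s -> F z = 0) ->
  \sum_(z <- t) F z = \sum_(z <- s) F z.
Proof.
move=> us ut sub F0; rewrite (bigID (mem s)) /= [X in _ + X]big1 ?addr0 //.
rewrite -big_filter; apply: perm_big; apply: uniq_perm (filter_uniq _ ut) us _.
by move=> z; rewrite mem_filter /=; case zs: (z \in s) => //=; rewrite (sub _ zs).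
Qed.

Lemma add_morph0 (V W : zmodType) (f : V -> W) :
  (forall x y, f (x + y) = f x + f y) -> f 0 = 0.
Proof. by move=> fD; apply: (addrI (f 0)); rewrite -fD !addr0. Qed.

Lemma add_morph_sum (V W : zmodType) (f : V -> W) (I : Type) (s : seq I) (P : pred I) F :
  (forall x y, f (x + y) = f x + f y) ->
  f (\sum_(i <- s | P i) F i) = \sum_(i <- s | P i) f (F i).
Proof. by move=> fD; apply: (big_morph f fD (add_morph0 fD)). Qed.

Section FreegSum.
Variables (S : nzRingType) (T : choiceType) (W : zmodType).
Variable G : T -> S -> W.
Hypothesis GD : forall z c d, G z (c + d) = G z c + G z d.

(** The additive extension of [G] to formal sums.  Unlike the linear lift of
formal sums, it lets the coefficients act through [G], so that [W] need not be a
module over them. *)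
Definition freeg_sum (D : {freeg T / S}) : W := \sum_(z <- dom D) G z (coeff z D).

Lemma freeg_sum_sub (s : seq T) D : uniq s -> {subset dom D <= s} ->
  freeg_sum D = \sum_(z <- s) G z (coeff z D).
Proof.
move=> us sub; apply/esym/big_uniq_sub => //; first exact: uniq_dom.
by move=> z /coeff_outdom ->; apply: add_morph0.
Qed.

Lemma freeg_sumD D1 D2 : freeg_sum (D1 + D2) = freeg_sum D1 + freeg_sum D2.
Proof.
pose s := undup (dom D1 ++ dom D2).
have us : uniq s by exact: undup_uniq.
rewrite !(@freeg_sum_sub s) //.
- by rewrite -big_split; apply: eq_bigr => z _; rewrite coeffD GD.
- by move=> z z2; rewrite mem_undup mem_cat z2 orbT.
- by move=> z z1; rewrite mem_undup mem_cat z1.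
- by move=> z zD; rewrite mem_undup; apply: domD_subset.
Qed.

Lemma freeg_sumU c z : freeg_sum << c *g z >> = G z c.
Proof.
rewrite (@freeg_sum_sub [:: z]) //.
  by rewrite big_seq1 coeffU eqxx mulr1.
by move=> y; rewrite mem_dom coeffU inE; case: (eqVneq z y) => //= _; rewrite mulr0 eqxx.
Qed.
End FreegSum.

(** * Semilinear models of the Frobenius pullback *)

Section FrobeniusModel.
Variables (A : comNzRingType) (p : nat).

Definition semilinear (N : lmodType A) (J : N -> N) : Prop :=
  (forall x y, J (x + y) = J x + J y) /\ forall a x, J (a *: x) = a ^+ p *: J x.

(** [J] exhibits [N] as its own Frobenius pullback: [x (x) y |-> x *: J y] is an
isomorphism from [A^1 (x)_A N] to [N].  Surjectivity is the second field; for
injectivity the tensor product is replaced by its universal property, tested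
against semilinear maps [psi] into modules over any [A]-algebra [S], because the
intended target is the Frobenius pullback of a module over a polynomial ring. *)
Record frob_model (N : lmodType A) (J : N -> N) : Prop := FrobModel {
  frob_model_semilinear : semilinear J;
  frob_model_span : forall y, exists s : seq (A * N), y = \sum_(z <- s) z.1 *: J z.2;
  frob_model_universal : forall (S : comNzRingType) (h : {rmorphism A -> S})
      (T : lmodType S) (psi : N -> T),
    (forall x y, psi (x + y) = psi x + psi y) ->
    (forall a x, psi (a *: x) = h a ^+ p *: psi x) ->
    forall s : seq (A * N), \sum_(z <- s) z.1 *: J z.2 = 0 ->
      \sum_(z <- s) h z.1 *: psi z.2 = 0 }.

(** In [A^1 (x)_A C] a sum of tensors involves finitely many elements of [C],
which all lie in one cyclic submodule generated by some [g], so the sum is a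
single tensor [y (x) g].  It remains that [y] kills [J g] only if [y = y' z^p]
with [z] killing [g], whence [y (x) g = y' (x) z g = 0].  The predicate [G]
restricts [g] to generators for which this is easy to verify. *)
Lemma locally_cyclic_model (C : lmodType A) (G : C -> Prop) (J : C -> C) :
  semilinear J ->
  (forall x y, exists g c d, [/\ G g, x = c *: g & y = d *: g]) ->
  (forall y, exists c x, y = c *: J x) ->
  (forall g y, G g -> y *: J g = 0 -> exists z y', y = y' * z ^+ p /\ z *: g = 0) ->
  frob_model J.
Proof.
move=> sJ lc sp ann; split=> //.
  by move=> y; have [c [x ->]] := sp y; exists [:: (c, x)]; rewrite big_seq1.
move=> S h T psi psiD psiZ s.
have [g [Gg hs]] : exists g, G g /\ forall z, z \in s -> exists c, z.2 = c *: g.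
  elim: s => [|x s [g [Gg IH]]].
    by have [g [_ [_ [Gg _ _]]]] := lc 0 0; exists g.
  have [g' [c [d [Gg' xE gE]]]] := lc x.2 g.
  exists g'; split=> // z; rewrite inE => /orP[/eqP ->|/IH[e ->]]; first by exists c.
  by exists (e * d); rewrite gE scalerA.
have [y [-> ->]] : exists y, \sum_(z <- s) z.1 *: J z.2 = y *: J g /\
    \sum_(z <- s) h z.1 *: psi z.2 = h y *: psi g.
  elim: s hs => [|x s IH] hs; first by exists 0; rewrite !big_nil rmorph0 !scale0r.
  have [y [e1 e2]] := IH (fun z zs => hs z (@mem_behead _ (x :: s) z zs)).
  have [c cE] := hs x (mem_head _ _).
  exists (x.1 * c ^+ p + y); rewrite !big_cons e1 e2 cE sJ.2 psiZ !scalerA.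
  by rewrite rmorphD rmorphM rmorphXn !scalerDl.
move=> /ann[//|z [y' [-> zg]]].
by rewrite rmorphM rmorphXn -scalerA -psiZ zg (add_morph0 psiD) scaler0.
Qed.

Lemma frob_model_ffun (I : finType) (N : lmodType A) (J : N -> N) :
  frob_model J -> @frob_model {ffun I -> N} (fun x => [ffun i => J (x i)]).
Proof.
case=> [[JD JZ] sp un].
have J0 := add_morph0 JD.
pose del (i : I) (x : N) : {ffun I -> N} := [ffun j => if j == i then x else 0].
have delD i x y : del i (x + y) = del i x + del i y.
  by apply/ffunP=> j; rewrite !ffunE; case: eqP; rewrite ?addr0.
have delZ i a x : del i (a *: x) = a *: del i x.
  by apply/ffunP=> j; rewrite !ffunE; case: eqP; rewrite ?scaler0.
have delE (x : {ffun I -> N}) : x = \sum_i del i (x i).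
  apply/ffunP=> j; rewrite sum_ffunE (bigD1 j) //= ffunE eqxx big1 ?addr0 // => i.
  by rewrite ffunE eq_sym => /negbTE ->.
split.
- by split=> [x y|a x]; apply/ffunP=> i; rewrite !ffunE ?JD ?JZ.
- move=> y; have /choice[s sE] :
    forall i, exists s : seq (A * N), y i = \sum_(z <- s) z.1 *: J z.2.
    by move=> i; apply: sp.
  exists (flatten [seq [seq (z.1, del i z.2) | z <- s i] | i <- enum I]).
  rewrite big_flatten big_map big_enum /= [LHS]delE; apply: eq_bigr => i _.
  rewrite sE big_map (add_morph_sum _ _ _ (delD i)).
  apply: eq_bigr => z _; rewrite delZ; congr (_ *: _).
  by apply/ffunP=> j; rewrite !ffunE; case: eqP.
- move=> S h T psi psiD psiZ s s0.
  have -> : \sum_(z <- s) h z.1 *: psi z.2 =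
      \sum_i \sum_(z <- [seq (z.1, z.2 i) | z : A * {ffun I -> N} <- s]) h z.1 *: psi (del i z.2).
    rewrite (eq_bigr (fun i => \sum_(z <- s) h z.1 *: psi (del i (z.2 i)))); last first.
      by move=> i _; rewrite big_map.
    rewrite exchange_big /=; apply: eq_bigr => z _.
    by rewrite -scaler_sumr -(add_morph_sum _ _ _ psiD) -delE.
  apply: big1 => i _; apply: (un S h T (fun x => psi (del i x))).
  + by move=> x y; rewrite delD psiD.
  + by move=> a x; rewrite delZ psiZ.
  + move/ffunP: s0 => /(_ i); rewrite sum_ffunE ffunE big_map => s0.
    by rewrite -[RHS]s0; apply: eq_bigr => z _; rewrite !ffunE.
Qed.

Lemma frob_model_pair (N N' : lmodType A) (J : N -> N) (J' : N' -> N') :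
  frob_model J -> frob_model J' ->
  @frob_model (N * N')%type (fun x => (J x.1, J' x.2)).
Proof.
case=> [[JD JZ] sp un] [[JD' JZ'] sp' un'].
have J0 := add_morph0 JD; have J0' := add_morph0 JD'.
have sum_pair (s : seq (A * (N * N'))) :
    \sum_(z <- s) z.1 *: (J z.2.1, J' z.2.2) =
    (\sum_(z <- s) z.1 *: J z.2.1, \sum_(z <- s) z.1 *: J' z.2.2).
  by elim: s => [|z s IH]; rewrite ?big_nil // !big_cons IH.
split.
- by split=> [x y|a x] /=; rewrite ?JD ?JD' ?JZ ?JZ'.
- move=> [y y']; have [s sE] := sp y; have [s' sE'] := sp' y'.
  exists ([seq (z.1, (z.2, 0)) | z <- s] ++ [seq (z.1, (0, z.2)) | z <- s']).
  rewrite sum_pair !big_cat !big_map /= -sE -sE'.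
  by congr (_, _); rewrite big1 ?add0r ?addr0 // => z _; rewrite ?J0 ?J0' scaler0.
- move=> S h T psi psiD psiZ s; rewrite sum_pair => -[s0 s0'].
  have psiE x : psi x = psi (x.1, 0) + psi (0, x.2).
    by rewrite -psiD; congr (psi _); case: x => x y; congr (_, _); rewrite /= ?addr0 ?add0r.
  under eq_bigr => z _ do rewrite psiE scalerDr.
  rewrite big_split /=.
  have := un S h T (fun x => psi (x, 0)) _ _ [seq (z.1, z.2.1) | z <- s].
  have := un' S h T (fun x => psi (0, x)) _ _ [seq (z.1, z.2.2) | z <- s].
  rewrite !big_map /= => -> //; last 2 first.
  + by move=> x y; rewrite -psiD; congr (psi (_, _)); rewrite /= addr0.
  + by move=> a x; rewrite -psiZ; congr (psi (_, _)); rewrite /= scaler0.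
  move=> -> //; rewrite ?addr0 //.
  + by move=> x y; rewrite -psiD; congr (psi (_, _)); rewrite /= addr0.
  + by move=> a x; rewrite -psiZ; congr (psi (_, _)); rewrite /= scaler0.
Qed.

End FrobeniusModel.

(** * Power series and the injective hull of the residue field *)

Section PowerSeriesFacts.
Variable K : fieldType.
Local Notation A := (fps K).
Local Notation Y := (fpsY K).
Implicit Types a b : A.

Lemma fcoefMn a i m : fcoef (a *+ m) i = fcoef a i *+ m.
Proof. by elim: m => // m IH; rewrite !mulrS -IH. Qed.

Lemma fcoef0M a b : fcoef (a * b) 0 = fcoef a 0 * fcoef b 0.
Proof. by rewrite /= big_ord1. Qed.

Lemma fpsY_mul a : fcoef a 0 = 0 -> a = Y * Fps (fun i => fcoef a i.+1).
Proof.
move=> a0; apply: fpsP => -[|i] /=; first by rewrite big_ord1 mul0r.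
rewrite !big_ord_recl /= mul0r mul1r add0r big1 ?addr0 ?subn1 // => j _.
by rewrite mul0r.
Qed.

Lemma fpsY_unit_or_mul a : a \is a GRing.unit \/ exists b, a = Y * b.
Proof.
case: (eqVneq (fcoef a 0) 0) => [/fpsY_mul ->|]; last by left.
by right; eexists.
Qed.

Lemma fpsY_neq0 : Y != 0.
Proof.
by apply/eqP => /(congr1 (fun a => fcoef a 1)) /eqP; rewrite /= oner_eq0.
Qed.

Lemma fps_factor a : a != 0 -> exists m u, u \is a GRing.unit /\ a = Y ^+ m * u.
Proof.
case/fps_neq0_order=> m; elim: m a => [|m IH] a am amin.
  by exists 0, a; rewrite mul1r.
have aE := fpsY_mul (amin 0 isT).
have [|i lt|k [u [uu bE]]] := IH (Fps (fun i => fcoef a i.+1)) => //.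
  exact: amin.
by exists k.+1, u; rewrite exprS -mulrA -bE.
Qed.

Lemma pchar_fps p : p \in [pchar K] -> p \in [pchar A].
Proof.
move=> hp; rewrite inE (pcharf_prime hp) /=; apply/eqP/fpsP => i.
rewrite fcoefMn /=.
by case: eqP => _; rewrite ?(pcharf0 hp) ?mul0rn.
Qed.

End PowerSeriesFacts.

Section InjectiveHull.
Variable K : fieldType.
Local Notation A := (fps K).
Local Notation Y := (fpsY K).
Variables (E : lmodType A) (iota : {linear residue_mod K -> E}).
Hypothesis hE : injective_hull iota.

(** Injectivity extends [r |-> r *: x] along multiplication by [Y] on [A]; the
image of [1] under the extension is the required quotient. *)
Lemma hull_divisible (x : E) : exists y, x = Y *: y.
Proof.
have [inj _ _] := hE.
pose mulY : A^o -> A^o := fun r => r * Y.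
have mulYl : linear mulY by move=> a r s; rewrite /mulY mulrDl -[a *: r]/(a * r) -mulrA.
pose fx : A^o -> E := fun r => r *: x.
have fxl : linear fx by move=> a r s; rewrite /fx scalerDl scalerA.
pose mYL := GRing.isLinear.Build A A^o A^o *:%R mulY mulYl.
pose fxL := GRing.isLinear.Build A A^o E *:%R fx fxl.
pose mY : {linear A^o -> A^o} := HB.pack mulY mYL.
pose f : {linear A^o -> E} := HB.pack fx fxL.
have [|g gE] := inj A^o A^o mY f.
  by move=> r s /(mulIf (fpsY_neq0 K)).
exists (g 1); rewrite -linearZ -[x]scale1r -[1 *: x]/(f 1) -gE /= /mulY mul1r.
by congr (g _); rewrite -[Y *: _]/(Y * 1) mulr1.
Qed.

Lemma residue_torsion (q : residue_mod K) : Y *: q = 0.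
Proof.
rewrite -[q]lquot_repr -linearZ -(linear0 (lquot_pi _)); apply/lquot_piE.
rewrite subr0 -[Y *: _]/(Y * _) mulrC -[_ * _]addr0; apply: generatedD => //.
exact: generated0.
Qed.

Lemma residue_pi1_neq0 : lquot_pi (fun x : A^o => x = Y) 1 != 0 :> residue_mod K.
Proof.
apply/eqP; rewrite -(linear0 (lquot_pi _)) => /lquot_piE; rewrite subr0 => gen1.
suff : fcoef (1 : A) 0 = 0 by move/eqP; rewrite /= oner_eq0.
elim: gen1 => [//|a x y -> _ IH].
by rewrite -[LHS]/(fcoef (a * Y) 0 + fcoef y 0) IH addr0 fcoef0M mulr0.
Qed.

(** A nonzero cyclic submodule meets the residue field, so some nonzero
[r = Y^m u] sends [x] into the socle, where [Y] acts as zero. *)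
Lemma hull_torsion (x : E) : exists k, Y ^+ k *: x = 0.
Proof.
have [_ _ ess] := hE.
case: (eqVneq x 0) => [->|x0]; first by exists 0; rewrite scaler0.
have [||y [r rE] ny] := ess (fun z => exists r : A, z = r *: x).
- split=> [|a _ _ [r ->] [s ->]]; first by exists 0; rewrite scale0r.
  by exists (a * r + s); rewrite scalerDl scalerA.
- by exists x => //; exists 1; rewrite scale1r.
have r0 : r != 0 by apply: contraNneq ny => r0; rewrite rE r0 scale0r.
have [m [u [uu rmu]]] := fps_factor r0.
exists m.+1; have := congr1 (fun z => u^-1 *: (Y *: z)) rE.
rewrite /= -[Y *: iota y]linearZ residue_torsion linear0 scaler0 !scalerA rmu => ->.
by congr (_ *: _); rewrite exprS [Y ^+ m * u]mulrC mulrCA mulKr.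
Qed.

(** If [Y] kills [x], a multiple [r *: x] is nonzero only for a unit [r]; hence
the multiple of [x] that essentiality finds in the residue field generates the
same submodule as [x]. *)
Lemma hull_socle (x : E) : Y *: x = 0 ->
  exists c, x = c *: iota (lquot_pi (fun x : A^o => x = Y) 1).
Proof.
have [_ _ ess] := hE => Yx.
case: (eqVneq x 0) => [->|x0]; first by exists 0; rewrite scale0r.
have [||y [r rE] ny] := ess (fun z => exists r : A, z = r *: x).
- split=> [|a _ _ [r ->] [s ->]]; first by exists 0; rewrite scale0r.
  by exists (a * r + s); rewrite scalerDl scalerA.
- by exists x => //; exists 1; rewrite scale1r.
have [ur|[b bE]] := fpsY_unit_or_mul r; last first.
  by move: ny; rewrite rE bE mulrC -scalerA Yx scaler0 eqxx.
have [c yE] : exists c : A, y = c *: lquot_pi _ 1.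
  exists (repr y); rewrite -linearZ -[LHS]lquot_repr; congr (lquot_pi _ _).
  by rewrite -[RHS]/((repr y : A) * 1) mulr1.
exists (r^-1 * c); rewrite -scalerA -[c *: iota _]linearZ -yE.
by rewrite rE scalerA mulVr // scale1r.
Qed.

(** An explicit form of the classical description of [E] as [Q(A) / A]: the
element [g k] plays the role of the class of [Y^-k], so it generates the
[Y^k]-torsion of [E] and has annihilator [(Y^k)]. *)
Lemma hull_chain : exists g : nat -> E,
  [/\ g 0 = 0, forall k, Y *: g k.+1 = g k,
      forall x k, Y ^+ k *: x = 0 -> exists c, x = c *: g k
    & forall r k, r *: g k = 0 -> exists b, r = b * Y ^+ k].
Proof.
have [_ inj _] := hE.
have [div divE] := choice hull_divisible.
set e := iota (lquot_pi (fun x : A^o => x = Y) 1).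
have e0 : e != 0.
  by apply: contra_neq residue_pi1_neq0 => e0; apply: inj; rewrite linear0.
have Ye : Y *: e = 0 by rewrite -linearZ residue_torsion linear0.
pose g k := if k is k'.+1 then iter k' div e else 0.
have gY k : Y *: g k.+1 = g k by case: k => [|k]; rewrite /g //= -divE.
have gYn d k : Y ^+ d *: g (d + k)%N = g k.
  by elim: d k => [|d IH] k; rewrite ?scale1r // exprSr -scalerA addSn gY IH.
exists g; split=> // [x k|r k].
  elim: k x => [|k IH] x; first by rewrite scale1r => ->; exists 0; rewrite scaler0.
  rewrite exprSr -scalerA => /IH[c cE].
  (* Both [x] and [c *: g k.+1] become [c *: g k] after multiplication by [Y]. *)
  have [|d dE] := @hull_socle (x - c *: g k.+1).
    by rewrite scalerBr cE scalerA mulrC -scalerA gY subrr.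
  exists (c + d * Y ^+ k); apply/eqP; rewrite scalerDl addrC -subr_eq dE -scalerA.
  by rewrite -[k.+1]addn1 gYn.
case: (eqVneq r 0) => [->|/fps_factor[m [u [uu ->]]]]; first by exists 0; rewrite mul0r.
case: (leqP k m) => [km _|mk].
  by exists (Y ^+ (m - k) * u); rewrite mulrAC -exprD subnK.
move=> /(congr1 (fun z => u^-1 *: z)); rewrite scalerA scaler0 mulrCA mulVr // mulr1.
rewrite -(subnKC mk) addSnnS gYn => /(congr1 (fun z => Y ^+ (k - m.+1) *: z)).
by rewrite -[(k - m.+1).+1]addn1 gYn scaler0 => /eqP; rewrite (negbTE e0).
Qed.

End InjectiveHull.

(** * The three indecomposable summands are Frobenius models *)

Lemma fraction_denom (R : idomainType) (q : {fraction R}) :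
  exists c d : R, d != 0 /\ q = tofrac c / tofrac d.
Proof.
elim/quotW: q => r; exists (frac r).1, (frac r).2; have d0 := denom_ratioP r.
split=> //; apply: (canRL (mulfK _)); first by rewrite tofrac_eq0.
unlock FracField.tofrac; rewrite -[LHS]FracField.pi_mul; apply/eqmodP.
by rewrite /= FracField.equivfE /FracField.mulf !numden_Ratio ?mulf_neq0 ?oner_eq0 // !mulr1 mulrC.
Qed.

Section Models.
Variables (K : fieldType) (p : nat).
Hypothesis hp : p \in [pchar K].
Local Notation A := (fps K).
Local Notation Y := (fpsY K).

Lemma exprD_pchar (R : comNzRingType) (x y : R) : p \in [pchar R] ->
  (x + y) ^+ p = x ^+ p + y ^+ p.
Proof. by move=> hR; rewrite exprDn_pchar // pnatE ?(pcharf_prime hR). Qed.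

Lemma regular_model : @frob_model A p A^o (fun x : A => x ^+ p).
Proof.
apply: (@locally_cyclic_model A p A^o (fun g => g = (1 : A)) (fun x : A => x ^+ p)).
- split=> [x y|a x]; first exact: (@exprD_pchar A x y (pchar_fps hp)).
  exact: exprMn.
- move=> x y; exists (1 : A), x, y; split=> //.
    exact: esym (mulr1 (x : A)).
  exact: esym (mulr1 (y : A)).
- by move=> y; exists (y : A), (1 : A); rewrite expr1n; apply: esym (mulr1 (y : A)).
- move=> _ y -> y0; exists 0, 0; split; last exact: mul0r.
  by rewrite mul0r; move: y0; rewrite expr1n => /(etrans (esym (mulr1 (y : A)))).
Qed.

Definition frac_inv (d : A) : fracmod A := (tofrac d : {fraction A})^-1.

Lemma fracmod_denom (q : fracmod A) :
  exists d c : A, d != 0 /\ q = c *: frac_inv d.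
Proof.
have [c [d [d0 qE]]] := fraction_denom q.
by exists d, c; rewrite qE.
Qed.

Lemma fraction_model : @frob_model A p (fracmod A) (fun q => (q : {fraction A}) ^+ p).
Proof.
have p0 : (0 < p)%N := prime_gt0 (pcharf_prime hp).
have hpQ : p \in [pchar {fraction A}].
  exact: (@rmorph_pchar _ _ (@FracField.tofrac A) p (pchar_fps hp)).
apply: (@locally_cyclic_model A p (fracmod A) (fun=> True)
  (fun q => (q : {fraction A}) ^+ p)).
- split=> [x y|a x]; first exact: (@exprD_pchar {fraction A} x y hpQ).
  rewrite -[RHS]/(tofrac (a ^+ p) * (x : {fraction A}) ^+ p) tofracXn -exprMn //.
- move=> x y; have [d [c [d0 ->]]] := fracmod_denom x.
  have [d' [c' [d'0 ->]]] := fracmod_denom y.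
  exists (frac_inv (d * d')), (c * d'), (c' * d); split=> //.
    rewrite -scalerA; congr (_ *: _); rewrite -[RHS]/(tofrac d' * (tofrac (d * d'))^-1).
    by rewrite tofracM invfM mulrCA divff ?mulr1 // tofrac_eq0.
  rewrite -scalerA; congr (_ *: _); rewrite -[RHS]/(tofrac d * (tofrac (d * d'))^-1).
  by rewrite tofracM invfM mulrA divff ?mul1r // tofrac_eq0.
- move=> y; have [d [c [d0 ->]]] := fracmod_denom y.
  exists (c * d ^+ p.-1), (frac_inv d).
  rewrite -[LHS]/(tofrac c * (tofrac d)^-1).
  rewrite -[RHS]/(tofrac (c * d ^+ p.-1) * (tofrac d)^-1 ^+ p).
  rewrite tofracM tofracXn -mulrA; congr (_ * _).
  by rewrite -{2}(prednK p0) exprSr mulrA -exprMn divff ?expr1n ?mul1r // tofrac_eq0.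
- move=> g y _ /eqP; rewrite -[_ *: _]/(tofrac y * (g : {fraction A}) ^+ p) mulf_eq0.
  rewrite tofrac_eq0 expf_eq0 p0 /= => /orP[/eqP ->|/eqP ->].
    by exists 0, 0; rewrite mul0r; split=> //; rewrite scale0r.
  by exists 1, y; rewrite expr1n mulr1; split=> //; apply: (@scaler0 A (fracmod A)).
Qed.

(** In terms of [Q(A) / A] the semilinear map is [q |-> q^p], that is
[c / Y^k |-> c^p / Y^(p k)].  Over a common denominator [Y^k], two numerators of the
same element differ by a multiple of [Y^k], whose [p]-th power is killed by [Y^(p k)], so the map is
well defined. *)
Lemma hull_model (E : lmodType A) (iota : {linear residue_mod K -> E}) :
  injective_hull iota -> exists J : E -> E, frob_model p J.
Proof.
move=> hE; have p0 : (0 < p)%N := prime_gt0 (pcharf_prime hp).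
have [g [g0 gY gsp gann]] := hull_chain hE.
have gYn d k : Y ^+ d *: g (d + k)%N = g k.
  by elim: d k => [|d IH] k; rewrite ?scale1r // exprSr -scalerA addSn gY IH.
have gle k l : (k <= l)%N -> g k = Y ^+ (l - k) *: g l.
  by move=> kl; rewrite -{2}(subnK kl) gYn.
have /choice[J0 J0E] : forall x, exists ck : A * nat, x = ck.1 *: g ck.2.
  by move=> x; have [k /gsp[c]] := hull_torsion hE x; exists (c, k).
pose J x := (J0 x).1 ^+ p *: g (p * (J0 x).2)%N.
have wd c d k l : (k <= l)%N -> c *: g k = d *: g l ->
    c ^+ p *: g (p * k)%N = d ^+ p *: g (p * l)%N.
  move=> kl; rewrite (gle k l kl) (gle (p * k) (p * l))%N ?leq_pmul2l //.
  rewrite -mulnBr mulnC exprM !scalerA -exprMn => /eqP.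
  rewrite -subr_eq0 -scalerBl => /eqP/gann[b /(canRL (subrK _)) ->].
  rewrite exprD_pchar ?pchar_fps // exprMn -exprM [(l * p)%N]mulnC scalerDl.
  by rewrite -scalerA -{2}[(p * l)%N]addn0 gYn g0 scaler0 add0r.
have JE c k : J (c *: g k) = c ^+ p *: g (p * k)%N.
  rewrite /J; set x := c *: g k; have := J0E x; rewrite {1}/x.
  case/orP: (leq_total k (J0 x).2) => [le /wd -> //|le /esym /wd -> //].
have lc x y : exists k c d, x = c *: g k /\ y = d *: g k.
  have [c [k xE]] : exists c k, x = c *: g k by exists (J0 x).1, (J0 x).2.
  have [d [l yE]] : exists c k, y = c *: g k by exists (J0 y).1, (J0 y).2.
  exists (maxn k l), (c * Y ^+ (maxn k l - k)), (d * Y ^+ (maxn k l - l)).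
  by rewrite -!scalerA -!gle ?leq_maxl ?leq_maxr.
exists J; apply: (@locally_cyclic_model _ _ _ (fun x => exists k, x = g k)).
- split=> [x y|a x].
    have [k [c [d [-> ->]]]] := lc x y.
    by rewrite -scalerDl !JE exprD_pchar ?pchar_fps // scalerDl.
  by rewrite (J0E x) scalerA !JE exprMn scalerA.
- move=> x y; have [k [c [d [xE yE]]]] := lc x y.
  by exists (g k), c, d; split=> //; exists k.
- move=> y; rewrite (J0E y); set c := (J0 y).1; set k := (J0 y).2.
  have kle : (k <= p * k)%N by rewrite leq_pmull.
  exists (c * Y ^+ (p * k - k)), (1 *: g k).
  by rewrite JE expr1n scale1r -scalerA -gle.
(* Here [g k] is sent to [g (p * k)], whose annihilator is generated by
   [Y ^+ (p * k)], the [p]-th power of a generator of the annihilator of [g k]. *)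
- move=> _ y [k ->]; rewrite -[g k]scale1r JE expr1n scale1r => /gann[b ->].
  exists (Y ^+ k), b; rewrite mulnC exprM; split=> //.
  by rewrite scale1r -{2}[k]addn0 gYn.
Qed.

End Models.

(** * Uniqueness of the multiplicities *)

Lemma left_kernel_leq (F : fieldType) (m n : nat) (X : 'M[F]_(m, n)) :
  (forall u : 'rV_m, u *m X = 0 -> u = 0) -> (m <= n)%N.
Proof.
move=> inj; suff /eqP <- : row_free X by exact: rank_leq_col.
rewrite -kermx_eq0; apply/eqP/row_matrixP=> i; rewrite row0; apply: inj.
by rewrite -row_mul mulmx_ker row0.
Qed.

Lemma common_denom (R : idomainType) (m : nat) (u : 'rV[{fraction R}]_m) :
  exists (d : R) (r : 'I_m -> R), d != 0 /\ forall i, tofrac d * u 0 i = tofrac (r i).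
Proof.
have /choice[n nE] : forall i, exists nd : R * R,
    nd.2 != 0 /\ u 0 i = tofrac nd.1 / tofrac nd.2.
  by move=> i; have [x [y [y0 ->]]] := fraction_denom (u 0 i); exists (x, y).
exists (\prod_i (n i).2), (fun i => (n i).1 * \prod_(j | j != i) (n j).2).
split=> [|i]; first by apply/prodf_neq0 => i _; have [] := nE i.
have [n0 ->] := nE i.
by rewrite (bigD1 i) //= !tofracM mulrC -mulrA mulKf ?tofrac_eq0.
Qed.

Section Multiplicities.
Variables (K : fieldType).
Local Notation A := (fps K).
Local Notation Y := (fpsY K).
Local Notation Q := {fraction A}.
Variables (E : lmodType A) (iota : {linear residue_mod K -> E}).
Hypothesis hE : injective_hull iota.

Definition sum_mod (a b c : nat) : lmodType A :=
  ({ffun 'I_a -> E} * {ffun 'I_b -> fracmod A} * {ffun 'I_c -> A^o})%type.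

Definition fps_const (k : K) : A := Fps (fun i => if i == 0%N then k else 0).

Lemma fcoef0_sum (I : finType) (F : I -> A) :
  fcoef (\sum_i F i) 0 = \sum_i fcoef (F i) 0.
Proof. exact: (big_morph (fun a : A => fcoef a 0)). Qed.

Lemma fracY_inj (q : fracmod A) : Y *: q = 0 -> q = 0.
Proof.
move=> /eqP; rewrite -[_ *: _]/(tofrac Y * (q : Q)) mulf_eq0 tofrac_eq0.
by rewrite (negbTE (fpsY_neq0 K)) /= => /eqP.
Qed.

Lemma fpsY_inj (x : A^o) : Y *: x = 0 -> x = 0.
Proof.
move=> /eqP; rewrite -[_ *: _]/(Y * (x : A)) mulf_eq0.
by rewrite (negbTE (fpsY_neq0 K)) /= => /eqP.
Qed.

Variables (a b c a' b' c' : nat) (g : sum_mod a b c -> sum_mod a' b' c').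
Hypothesis g_lin : forall k x y, g (k *: x + y) = k *: g x + g y.

Lemma sum_mapD x y : g (x + y) = g x + g y.
Proof. by have := g_lin 1 x y; rewrite !scale1r. Qed.

Lemma sum_map0 : g 0 = 0.
Proof. exact: add_morph0 sum_mapD. Qed.

Lemma sum_mapZ k x : g (k *: x) = k *: g x.
Proof. by have := g_lin k x 0; rewrite !addr0 sum_map0 addr0. Qed.

Lemma sum_map_sum (I : finType) (k : I -> A) x :
  g (\sum_i k i *: x i) = \sum_i k i *: g (x i).
Proof.
by rewrite (add_morph_sum _ _ _ sum_mapD); apply: eq_bigr => i _; rewrite sum_mapZ.
Qed.

Lemma coordE_sum (I : finType) (k : I -> A) (x : I -> sum_mod a b c) j :
  (\sum_i k i *: x i).1.1 j = \sum_i k i *: (x i).1.1 j.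
Proof.
rewrite (add_morph_sum (f := fun x : sum_mod a b c => x.1.1 j)).
  by apply: eq_bigr => i _; rewrite ffunE.
by move=> y z; rewrite ffunE.
Qed.

(** The kernel of [Y] is [a]-dimensional over the residue field, because [Y] acts
injectively on [Q(A)] and on [A] and the socle of [E] is a line.  An injective map
therefore induces an injective [a] by [a'] matrix over [K]. *)
Lemma socle_dim_leq : injective g -> (a <= a')%N.
Proof.
move=> g_inj; set e := iota (lquot_pi (fun x : A^o => x = Y) 1).
have [_ iinj _] := hE.
have e0 : e != 0.
  by apply: contra_neq (residue_pi1_neq0 K) => e0; apply: iinj; rewrite linear0.
have Ye : Y *: e = 0 by rewrite -linearZ residue_torsion linear0.
pose v (i : 'I_a) : sum_mod a b c := ([ffun j => if j == i then e else 0], 0, 0).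
have Yv i : Y *: v i = 0.
  congr (_, _, _); rewrite ?scaler0 //.
  by apply/ffunP=> j; rewrite !ffunE; case: eqP; rewrite ?Ye ?scaler0.
have Ygv i : Y *: g (v i) = 0 by rewrite -sum_mapZ Yv sum_map0.
have /choice[M ME] : forall ij : 'I_a * 'I_a', exists k, (g (v ij.1)).1.1 ij.2 = k *: e.
  case=> i j; apply: (hull_socle hE); have := congr1 (fun x : sum_mod a' b' c' => x.1.1 j) (Ygv i).
  by rewrite /= !ffunE.
apply: (@left_kernel_leq K a a' (\matrix_(i, j) fcoef (M (i, j)) 0)) => u uM.
pose x := \sum_i fps_const (u 0 i) *: v i.
have gx : g x = 0.
  rewrite sum_map_sum.
  have zE j : (\sum_i fps_const (u 0 i) *: g (v i)).1.1 j = 0.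
    rewrite (add_morph_sum (f := fun x : sum_mod a' b' c' => x.1.1 j)); last first.
      by move=> y z; rewrite ffunE.
    rewrite (eq_bigr (fun i => (fps_const (u 0 i) * M (i, j)) *: e)); last first.
      by move=> i _; rewrite ffunE (ME (i, j)) scalerA.
    rewrite -scaler_suml.
    have /fpsY_mul-> : fcoef (\sum_i fps_const (u 0 i) * M (i, j)) 0 = 0.
      move/matrixP: uM => /(_ 0 j); rewrite !mxE => <-.
      by rewrite fcoef0_sum; apply: eq_bigr => i _; rewrite fcoef0M mxE.
    by rewrite mulrC -scalerA Ye scaler0.
  have YZ : Y *: (\sum_i fps_const (u 0 i) *: g (v i)) = 0.
    rewrite scaler_sumr big1 // => i _.
    by rewrite scalerA mulrC -scalerA Ygv scaler0.
  move: (\sum_i _) zE YZ => [[z1 z2] z3] /= zE YZ; congr (_, _, _); apply/ffunP=> j.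
  - by rewrite zE ffunE.
  - rewrite [RHS]ffunE; apply: fracY_inj; have := congr1 (fun x : sum_mod a' b' c' => x.1.2 j) YZ.
    by rewrite /= !ffunE.
  - rewrite [RHS]ffunE; apply: fpsY_inj; have := congr1 (fun x : sum_mod a' b' c' => x.2 j) YZ.
    by rewrite /= !ffunE.
have x0 : x = 0 by apply: g_inj; rewrite gx sum_map0.
apply/rowP=> i; rewrite mxE; have := congr1 (fun x : sum_mod a b c => x.1.1 i) x0.
rewrite coordE_sum /= ffunE (bigD1 i) //= ffunE eqxx big1 ?addr0; last first.
  by move=> j /negbTE ji; rewrite ffunE eq_sym ji scaler0.
move=> ue; apply/eqP; case: eqP => // /eqP u0; case/eqP: e0.
have uu : fps_const (u 0 i) \is a GRing.unit by [].
by rewrite -[e]scale1r -(mulVr uu) -scalerA ue scaler0.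
Qed.

Lemma hull_ffun_torsion (x : {ffun 'I_a' -> E}) : exists k, Y ^+ k *: x = 0.
Proof.
have /choice[k kE] := fun i => hull_torsion hE (x i).
exists (\sum_i k i)%N; apply/ffunP=> i; rewrite !ffunE (bigD1 i) //= addnC exprD -scalerA.
by rewrite kE scaler0.
Qed.

(** Up to torsion the modules have rank [b + c] and [b' + c']: the free module
[A^(b + c)] embeds in the source, and the kernel of the projection of the target
to [Q(A)^(b' + c')] is torsion, so the composite stays injective. *)
Lemma rank_leq : injective g -> (b + c <= b' + c')%N.
Proof.
move=> g_inj.
pose emb (r : 'I_(b + c) -> A) : sum_mod a b c :=
  (0, [ffun i => frac_scale (r (lshift c i)) (1 : Q)], [ffun i => r (rshift b i)]).
pose proj (y : sum_mod a' b' c') : 'rV[Q]_(b' + c') :=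
  row_mx (\row_i (y.1.2 i : Q)) (\row_i tofrac (y.2 i : A)).
have projD x y : proj (x + y) = proj x + proj y.
  rewrite /proj add_row_mx; congr row_mx; apply/rowP=> i; rewrite !mxE /= ffunE //.
  exact: tofracD.
have projZ k x : proj (k *: x) = tofrac k *: proj x.
  rewrite /proj scale_row_mx; congr row_mx; apply/rowP=> i; rewrite !mxE /= ffunE //.
  exact: tofracM.
have proj0 y : proj y = 0 -> exists k, Y ^+ k *: y = 0.
  rewrite -(row_mx0 _ 1 b' c') => /eq_row_mx[y1 y2].
  have [k kE] := hull_ffun_torsion y.1.1; exists k.
  case: y y1 y2 kE => [[z1 z2] z3] /= y1 y2 kE; congr (_, _, _) => //.
    by apply/ffunP=> i; move/rowP: y1 => /(_ i); rewrite !mxE !ffunE => ->; rewrite scaler0.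
  apply/ffunP=> i; move/rowP: y2 => /(_ i); rewrite !mxE !ffunE => /eqP.
  by rewrite tofrac_eq0 => /eqP ->; rewrite scaler0.
pose del (i j : 'I_(b + c)) : A := (j == i)%:R.
have embE r : emb r = \sum_i r i *: emb (del i).
  have sumE (i : 'I_(b + c)) : r i = \sum_j r j * del j i.
    rewrite (bigD1 i) //= /del eqxx mulr1 big1 ?addr0 // => j /negbTE ji.
    by rewrite eq_sym ji mulr0.
  rewrite [RHS]surjective_pairing [X in (X, _)]surjective_pairing; congr (_, _, _).
  - rewrite (add_morph_sum (f := fun x : sum_mod a b c => x.1.1)) // big1 // => i _.
    by rewrite /= scaler0.
  - apply/ffunP=> i; rewrite (add_morph_sum (f := fun x : sum_mod a b c => x.1.2 i)).
      rewrite ffunE sumE /frac_scale mulr1 rmorph_sum; apply: eq_bigr => j _.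
      by rewrite ffunE ffunE /= -[RHS]/(tofrac _ * (tofrac _ * 1)) mulr1 tofracM.
    by move=> x y; rewrite ffunE.
  - apply/ffunP=> i; rewrite (add_morph_sum (f := fun x : sum_mod a b c => x.2 i)).
      by rewrite ffunE sumE; apply: eq_bigr => j _; rewrite !ffunE.
    by move=> x y; rewrite ffunE.
apply: (@left_kernel_leq Q _ _ (\matrix_i proj (g (emb (del i))))) => u uM.
have [d [r [d0 rE]]] := common_denom u.
have [k kE] : exists k, Y ^+ k *: g (emb r) = 0.
  apply: proj0; rewrite embE sum_map_sum (add_morph_sum _ _ _ projD).
  transitivity (tofrac d *: (u *m \matrix_i proj (g (emb (del i))))); last first.
    by rewrite uM scaler0.
  rewrite mulmx_sum_row scaler_sumr; apply: eq_bigr => i _.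
  by rewrite projZ rowK scalerA rE.
have Y0 : Y ^+ k != 0 by rewrite expf_neq0 ?fpsY_neq0.
have e0 : Y ^+ k *: emb r = 0 by apply: g_inj; rewrite sum_mapZ kE sum_map0.
apply/rowP=> i; rewrite mxE; apply/eqP.
have d0' : tofrac d != 0 :> Q by rewrite tofrac_eq0.
rewrite -(mulrI_eq0 _ (mulfI d0')) rE tofrac_eq0.
case: (split_ordP i) => j ->.
  have /eqP := congr1 (fun x : sum_mod a b c => x.1.2 j) e0; rewrite /= !ffunE.
  rewrite -[_ *: _]/(tofrac _ * (tofrac _ * (1 : Q))) mulr1 mulf_eq0 !tofrac_eq0.
  by rewrite (negbTE Y0).
have /eqP := congr1 (fun x : sum_mod a b c => x.2 j) e0; rewrite /= !ffunE.
by rewrite -[_ *: _]/(_ * _) mulf_eq0 (negbTE Y0).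
Qed.

(** As [E] and [Q(A)] are divisible, the cokernel of [Y] on the sum is the space
of constant terms of the [A^c] coordinates, so it is [c]-dimensional over [K]; a
surjection induces a surjection on these cokernels. *)
Lemma cokernel_dim_leq : (forall y, exists x, g x = y) -> (c' <= c)%N.
Proof.
move=> g_surj.
pose del (i : 'I_c) : sum_mod a b c := (0, 0, [ffun j => (j == i)%:R : A]).
pose M : 'M[K]_(c, c') := \matrix_(i, j) fcoef ((g (del i)).2 j) 0.
suff /eqP <- : row_full M by exact: rank_leq_row.
apply/row_fullP; have /choice[u uE] : forall j : 'I_c', exists u : 'rV_c, u *m M = delta_mx 0 j.
  move=> j0; have [x gx] := g_surj (0, 0, [ffun j => (j == j0)%:R : A]).
  have /choice[div divE] := hull_divisible hE.
  pose x' : sum_mod a b c := ([ffun i => div (x.1.1 i)],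
     [ffun i => frac_scale 1 ((tofrac Y)^-1 * (x.1.2 i : Q))], 0).
  have xE : x = Y *: x' + \sum_i (x.2 i : A) *: del i.
    rewrite [LHS]surjective_pairing [RHS]surjective_pairing; congr (_, _).
      rewrite [LHS]surjective_pairing [RHS]surjective_pairing; congr (_, _).
        rewrite /= (add_morph_sum (f := fun x : sum_mod a b c => x.1.1)) // big1.
          by rewrite addr0; apply/ffunP=> i; rewrite !ffunE -divE.
        by move=> i _; rewrite /= scaler0.
      rewrite /= (add_morph_sum (f := fun x : sum_mod a b c => x.1.2)) // big1.
        rewrite addr0; apply/ffunP=> i; rewrite !ffunE.
        rewrite -[RHS]/(tofrac Y * (tofrac 1 * (_ * _))) tofrac1 mul1r mulVKf //.
        by rewrite tofrac_eq0 fpsY_neq0.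
      by move=> i _; rewrite /= scaler0.
    apply/ffunP=> i; rewrite /= scaler0 add0r.
    rewrite (add_morph_sum (f := fun x : sum_mod a b c => x.2 i)); last first.
      by move=> y z; rewrite ffunE.
    rewrite (bigD1 i) //= !ffunE eqxx big1 ?addr0; first exact: esym (mulr1 (x.2 i : A)).
    by move=> j /negbTE ji; rewrite !ffunE eq_sym ji; apply: mulr0.
  exists (\row_i fcoef (x.2 i) 0); apply/rowP=> j.
  have := congr1 (fun y : sum_mod a' b' c' => fcoef (y.2 j) 0) gx.
  rewrite {1}xE sum_mapD sum_mapZ sum_map_sum.
  rewrite /= !ffunE (add_morph_sum (f := fun x : sum_mod a' b' c' => x.2 j)); last first.
    by move=> y z; rewrite ffunE.
  rewrite -[fcoef _ _ in LHS]/(fcoef (Y * ((g x').2 j : A)) 0 + fcoef (\sum_i (_ : A)) 0).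
  rewrite fcoef0M mul0r add0r fcoef0_sum !mxE eqxx /=.
  have -> : fcoef (j == j0)%:R 0 = (j == j0)%:R :> K by case: eqP.
  move=> <-; apply: eq_bigr => i _; rewrite !mxE ffunE.
  by rewrite -[_ *: _]/((x.2 i : A) * ((g (del i)).2 j : A)) fcoef0M.
exists (\matrix_j u j); apply/row_matrixP=> j.
by rewrite row_mul rowK uE row1.
Qed.

End Multiplicities.

(** * Additive maps out of a Frobenius pullback *)

Section TensorElimination.
Variables (R : comNzRingType) (p : nat) (M : lmodType R).

Lemma Frob_ind (P : Frob p M -> Prop) :
  P 0 -> (forall x y, P x -> P y -> P (x + y)) -> (forall r m, P (ftensor p r m)) ->
  forall t, P t.
Proof.
move=> P0 PD Pt t; rewrite -[t]lquot_repr.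
move: (repr t) => {t} t; have -> : t = \sum_(z <- dom t) coeff z t *: fgen R z.
  apply/eqP/freeg_eqP=> z; rewrite raddf_sum /=.
  under eq_bigr => y _ do rewrite -[coeff z _]/(coeff z (fgscale _ _)) coeff_fgscale coeffU mul1r.
  rewrite -[LHS]/(coeff z t); have [zt|zt] := boolP (z \in dom t).
    rewrite (bigD1_seq z) ?uniq_dom //= eqxx mulr1 big1 ?addr0 // => y /negbTE ->.
    by rewrite mulr0.
  rewrite coeff_outdom // big1_seq // => y /andP[_ yt].
  by case: eqP => [yz|]; rewrite ?mulr0 //; move: zt; rewrite -yz yt.
rewrite raddf_sum; apply: big_ind => // -[r m] _; rewrite /= linearZ.
by have := Pt (coeff (r, m) t * r) m; rewrite ftensor_scale.
Qed.

Variables (W : zmodType) (B : R -> M -> W).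
Hypothesis BDl : forall r s m, B (r + s) m = B r m + B s m.
Hypothesis BDr : forall r m k, B r (m + k) = B r m + B r k.
Hypothesis Bbal : forall r s m, B (r * s ^+ p) m = B r (s *: m).

(** The universal property of [R^1 (x)_R M] for additive maps.  The target is only
an abelian group: the coordinates of a graded component are not [R]-linear. *)
Lemma Frob_elim : exists Phi : Frob p M -> W,
  (forall x y, Phi (x + y) = Phi x + Phi y) /\ forall r m, Phi (ftensor p r m) = B r m.
Proof.
pose G (z : R * M) c := B (c * z.1) z.2.
have GD z c d : G z (c + d) = G z c + G z d by rewrite /G mulrDl BDl.
pose phi (t : freemod R (R * M)%type) : W := freeg_sum G t.
have phiD t t' : phi (t + t') = phi t + phi t' by exact: freeg_sumD.
have phi0 : phi 0 = 0 by exact: add_morph0.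
have phiN t : phi (- t) = - phi t by apply: (addrI (phi t)); rewrite -phiD !subrr phi0.
have phiZ a r m : phi (a *: fgen R (r, m)) = B (a * r) m.
  have -> : a *: fgen R (r, m) = << a *g (r, m) >> :> freemod R (R * M)%type.
    apply/eqP/freeg_eqP => z; rewrite -[LHS]/(coeff z (fgscale _ _)).
    by rewrite coeff_fgscale !coeffU mul1r.
  exact: freeg_sumU.
have phi_rel t : generated (@frob_rel R p M) t -> phi t = 0.
  elim=> [//|a x y Sx _ IH]; rewrite phiD IH addr0.
  case: Sx => [r s m|r m k|r s m|s r m].
  - by rewrite !scalerBr !phiD !phiN !phiZ mulrDr BDl addrAC addrK subrr.
  - by rewrite !scalerBr !phiD !phiN !phiZ BDr addrAC addrK subrr.
  - by rewrite !scalerBr !phiD !phiN !phiZ mulrA Bbal subrr.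
  - by rewrite !scalerBr !phiD !phiN scalerA !phiZ mulrA subrr.
have phi_pi t : phi (repr (lquot_pi (@frob_rel R p M) t)) = phi t.
  apply/eqP; rewrite -subr_eq0 -phiN -phiD; apply/eqP/phi_rel.
  by apply/lquot_piE; rewrite lquot_repr.
exists (fun q : Frob p M => phi (repr q)); split=> [x y|r m].
  by rewrite -{1}[x]lquot_repr -{1}[y]lquot_repr -raddfD phi_pi phiD.
by rewrite phi_pi -[fgen R _]scale1r phiZ mul1r.
Qed.

End TensorElimination.

(** * Projection to a graded component *)

Section GradedComponent.
Variables (n : nat) (A : comNzRingType) (M : lmodType {mpoly A[n]}).
Variables (gr : mdegree n -> M -> Prop).
Hypothesis grM : is_grading gr.

Lemma grD u x y : gr u x -> gr u y -> gr u (x + y).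
Proof.
have [h _ _ _] := grM; have [u0 uB] := h u => ux uy.
by rewrite -[y]opprK; apply: (uB _ _ ux); rewrite -sub0r; apply: uB.
Qed.

Lemma grZ u k x : gr u x -> gr u (k%:MP *: x).
Proof.
have [_ h _ _] := grM => ux; rewrite -[u]add0r; apply: h => // m.
rewrite msuppC; case: eqP => //= _; rewrite inE => /eqP ->.
by apply/ffunP=> i; rewrite !ffunE mnmE.
Qed.

Definition decomposition (x : M) (f : mdegree n -> M) : Prop :=
  exists s : seq (mdegree n),
    [/\ uniq s, forall u, gr u (f u), forall u, u \notin s -> f u = 0
      & x = \sum_(u <- s) f u].

Lemma decomposition_ex x : exists f, decomposition x f.
Proof.
have [h0 _ h _] := grM; have [s [f [fgr ->]]] := h x.
exists (fun u => f u *+ count_mem u s), (undup s); split.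
- exact: undup_uniq.
- by move=> u; elim: (count_mem u s) => [|m IH]; [have [] := h0 u | rewrite mulrS; apply: grD].
- by move=> u; rewrite mem_undup => /count_memPn ->.
- by rewrite big_undup_iterop_count.
Qed.

Lemma decomposition_lin k x y f g : decomposition x f -> decomposition y g ->
  decomposition (k%:MP *: x + y) (fun u => k%:MP *: f u + g u).
Proof.
case=> s [us fgr f0 ->] [t [ut ggr g0 ->]]; exists (undup (s ++ t)); split.
- exact: undup_uniq.
- by move=> u; apply: grD => //; apply: grZ.
- move=> u; rewrite mem_undup mem_cat negb_or => /andP[/f0 -> /g0 ->].
  by rewrite scaler0 addr0.
- rewrite big_split -scaler_sumr /=; congr (_ *: _ + _); apply/esym/big_uniq_sub => //.
  + exact: undup_uniq.
  + by move=> z; rewrite mem_undup mem_cat => ->.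
  + exact: undup_uniq.
  + by move=> z; rewrite mem_undup mem_cat orbC => ->.
Qed.

Lemma decomposition_uniq x f g : decomposition x f -> decomposition x g -> f =1 g.
Proof.
have [_ _ _ h] := grM => df dg u.
have [s [us sgr s0 /esym sE]] := decomposition_lin (-1) dg df.
have x0 : (-1)%:MP_[n] *: x + x = 0 by rewrite rmorphN1 scaleN1r addNr.
have : f u - g u = 0.
  rewrite addrC -scaleN1r -(rmorphN1 (@mpolyC n A)); case: (boolP (u \in s)) => [|/s0 //].
  exact: (h s (fun u => (-1)%:MP *: g u + f u) us sgr (etrans sE x0) u).
by move/eqP; rewrite subr_eq0 => /eqP.
Qed.

Lemma decomposition_homogeneous w x : gr w x ->
  decomposition x (fun u => if u == w then x else 0).
Proof.
have [h0 _ _ _] := grM => wx; exists [:: w]; split=> //.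
- by move=> u; case: eqP => [->|_] //; have [] := h0 u.
- by move=> u; rewrite inE => /negbTE ->.
- by rewrite big_seq1 eqxx.
Qed.

Lemma component_projection w : exists pi : M -> M,
  [/\ forall k x y, pi (k%:MP *: x + y) = k%:MP *: pi x + pi y,
      forall x, gr w (pi x) & forall x, gr w x -> pi x = x].
Proof.
have [f df] := choice decomposition_ex.
exists (fun x => f x w); split=> [k x y|x|x wx].
- exact: (decomposition_uniq (df _) (decomposition_lin k (df x) (df y))).
- by have [s []] := df x.
- by rewrite (decomposition_uniq (df x) (decomposition_homogeneous wx)) eqxx.
Qed.

(** An isomorphism onto a component has a left inverse defined on all of [M],
namely its inverse precomposed with the projection to that component. *)
Lemma component_retraction w (N : lmodType A) (f : N -> M) :
  (forall k x y, f (k *: x + y) = k%:MP_[n] *: f x + f y) -> injective f ->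
  (forall m, gr w m <-> exists x, f x = m) ->
  exists rho : M -> N, (forall k x y, rho (k%:MP *: x + y) = k *: rho x + rho y) /\
    cancel f rho.
Proof.
move=> f_lin f_inj f_im; have [pi [pi_lin pi_gr pi_id]] := component_projection w.
have /choice[rho rhoE] : forall x, exists y, f y = pi x by move=> x; apply/f_im.
exists rho; split=> [k x y|x]; apply: f_inj; first by rewrite f_lin !rhoE pi_lin.
by rewrite rhoE pi_id //; apply/f_im; exists x.
Qed.

End GradedComponent.

(** * Components of the Frobenius pullback *)

Section Exponents.
Variables (n p : nat).

Definition mnm_div (m : 'X_{1..n}) : 'X_{1..n} := [multinom (m i %/ p)%N | i < n].
Definition mnm_mod (m : 'X_{1..n}) : 'X_{1..n} := [multinom (m i %% p)%N | i < n].

Definition deg_div (u : mdegree n) : mdegree n := [ffun i => (u i %/ p)%Z].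
Definition deg_mod (u : mdegree n) : 'X_{1..n} := [multinom `|(u i %% p)%Z|%N | i < n].

Hypothesis p0 : (0 < p)%N.

Lemma deg_modE u i : (deg_mod u i)%:Z = (u i %% p)%Z.
Proof. by rewrite mnmE gez0_abs // modz_ge0 // -lt0n. Qed.

Lemma mnm_div_muln m d : mnm_div (m + d *+ p)%MM = (mnm_div m + d)%MM.
Proof. by apply/mnmP=> i; rewrite !mnmE mulmnE divnDMl. Qed.

Lemma mnm_mod_muln m d : mnm_mod (m + d *+ p)%MM = mnm_mod m.
Proof. by apply/mnmP=> i; rewrite !mnmE mulmnE addnC modnMDl. Qed.

End Exponents.

Section Coordinate.
Variables (n p : nat) (A : comNzRingType).
Hypothesis hp : p \in [pchar A].
Variables (M : lmodType {mpoly A[n]}) (N : lmodType A) (J : M -> N).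
Hypothesis JD : forall x y, J (x + y) = J x + J y.
Hypothesis JZ : forall k x, J (k%:MP *: x) = k ^+ p *: J x.
Variable alpha : 'X_{1..n}.

(** The projection of [F(M)] to its summand [X^alpha A^1 (x)_A M], followed by the
map induced by a semilinear [J] out of [M]: writing [beta = alpha + p gamma], the
tensor [X^beta (x) m] equals [X^alpha (x) X^gamma m]. *)
Lemma Frob_coordinate : exists Phi : Frob p M -> N,
  [/\ forall x y, Phi (x + y) = Phi x + Phi y,
      forall k x, Phi (k%:MP *: x) = k *: Phi x
    & forall beta m, Phi (ftensor p 'X_[beta] m) =
        if mnm_mod p beta == alpha then J ('X_[mnm_div p beta] *: m) else 0].
Proof.
have p0 : (0 < p)%N := prime_gt0 (pcharf_prime hp).
have hpR : p \in [pchar {mpoly A[n]}].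
  exact: (@rmorph_pchar _ _ (@mpolyC n A) p hp).
pose H beta m : N := if mnm_mod p beta == alpha then J ('X_[mnm_div p beta] *: m) else 0.
have HD beta x y : H beta (x + y) = H beta x + H beta y.
  by rewrite /H; case: eqP => _; rewrite ?addr0 // scalerDr JD.
pose G m beta c : N := c *: H beta m.
have GD m beta c d : G m beta (c + d) = G m beta c + G m beta d by exact: scalerDl.
pose B (r : {mpoly A[n]}) m : N := freeg_sum (G m) (mpoly_val r).
have BDl r s m : B (r + s) m = B r m + B s m by exact: freeg_sumD.
have BDr r x y : B r (x + y) = B r x + B r y.
  by rewrite /B /freeg_sum -big_split; apply: eq_bigr => b _; rewrite /G HD scalerDr.
have B0l m : B 0 m = 0 by exact: (add_morph0 (fun r s => BDl r s m)).
have B0r r : B r 0 = 0 by exact: (add_morph0 (BDr r)).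
have BX c beta m : B (c *: 'X_[beta]) m = c *: H beta m.
  rewrite /B -[RHS](@freeg_sumU _ _ _ (G m)) //; congr freeg_sum.
  apply/eqP/freeg_eqP => z; rewrite coeffU -[LHS]/((c *: 'X_[beta])@_z).
  by rewrite mcoeffZ mcoeffX.
have HZ k beta m : H beta (k%:MP *: m) = k ^+ p *: H beta m.
  rewrite /H; case: eqP => _; last by rewrite scaler0.
  by rewrite -JZ !scalerA mulrC.
have Bbal r s m : B (r * s ^+ p) m = B r (s *: m).
  elim/mpolyind: s => [|c d s _ _ IHs].
    by rewrite expr0n -leqn0 leqNgt p0 mulr0 scale0r B0l B0r.
  rewrite exprD_pchar // mulrDr BDl IHs scalerDl BDr; congr (_ + _).
  elim/mpolyind: r {IHs} => [|k b r _ _ IHr]; first by rewrite mul0r !B0l.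
  rewrite mulrDl !BDl IHr; congr (_ + _).
  rewrite exprZn mpolyXn -scalerAl -scalerAr scalerA -mpolyXD !BX.
  rewrite -mul_mpolyC -[(_ * 'X_[d]) *: m]scalerA HZ scalerA; congr (_ *: _).
  rewrite /H mnm_mod_muln mnm_div_muln //; case: eqP => // _.
  by rewrite scalerA -mpolyXD.
have [Phi [PhiD PhiE]] := Frob_elim BDl BDr Bbal.
exists Phi; split=> // [k x|beta m]; last first.
  by rewrite PhiE -[RHS]scale1r -BX scale1r.
elim/Frob_ind: x => [|x y Hx Hy|r m].
- by rewrite scaler0 (add_morph0 PhiD) scaler0.
- by rewrite scalerDr !PhiD Hx Hy scalerDr.
rewrite -ftensor_scale !PhiE; elim/mpolyind: r => [|c b r _ _ IHr].
  by rewrite mulr0 !B0l scaler0.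
by rewrite mulrDr !BDl scalerDr IHr mul_mpolyC scalerA !BX scalerA.
Qed.

End Coordinate.

Section FrobeniusComponent.
Variables (n p : nat) (A : comNzRingType).
Hypothesis p0 : (0 < p)%N.
Variables (M : lmodType {mpoly A[n]}) (gr : mdegree n -> M -> Prop).
Hypothesis grM : is_grading gr.

Lemma multideg_deg_mod (u : mdegree n) : multideg (deg_mod p u) + deg_div p u *+ p = u.
Proof.
apply/ffunP=> i; rewrite !ffunE ffunMnE ffunE deg_modE // addrC.
by rewrite [RHS](divz_eq _ p) -mulr_natr natz.
Qed.

(** Only tensors [X^beta (x) m] with [beta] congruent to [u] modulo [p] have degree
[u], and the [p]-th power part of [X^beta] moves across the tensor sign, landing
[m] in degree [floor (u / p)]. *)
Lemma Frob_grading_component (u : mdegree n) t : Frob_grading gr u t <->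
  exists2 s : seq (A * M), forall z, z \in s -> gr (deg_div p u) z.2
    & t = \sum_(z <- s) z.1%:MP *: ftensor p 'X_[deg_mod p u] z.2.
Proof.
split.
  case=> k [r [m [v [w [hh ->]]]]].
  have [_ grA _ _] := grM.
  suff /choice[s sE] : forall i, exists s : seq (A * M),
      (forall z, z \in s -> gr (deg_div p u) z.2) /\
      ftensor p (r i) (m i) = \sum_(z <- s) z.1%:MP *: ftensor p 'X_[deg_mod p u] z.2.
    exists (flatten [seq s i | i <- enum 'I_k]).
      by move=> z /flatten_mapP[i _]; have [h _] := sE i; apply: h.
    by rewrite big_flatten big_map big_enum; apply: eq_bigr => i _; have [_] := sE i.
  move=> i; have [rv mw uE] := hh i.
  exists [seq ((r i)@_b, 'X_[mnm_div p b] *: m i) | b <- msupp (r i)]; split.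
    move=> z /mapP[b /rv bv ->] /=; suff <- : multideg (mnm_div p b) + w i = deg_div p u.
      by apply: grA mw => c; rewrite msuppX inE => /eqP ->.
    rewrite -uE -bv; apply/ffunP=> j; rewrite !ffunE ffunMnE mnmE.
    by rewrite -mulr_natr natz [in RHS]addrC divzMDl ?divz_nat 1?addrC // -lt0n.
  rewrite big_map [in LHS](mpolyE (r i)).
  rewrite (add_morph_sum (f := fun r => ftensor p r (m i))); last first.
    by move=> x y; apply: ftensor_addl.
  rewrite !big_seq; apply: eq_bigr => b /rv bv.
  rewrite -mul_mpolyC ftensor_scale /=; congr (_ *: _).
  rewrite -ftensor_bal mpolyXn -mpolyXD; congr (ftensor p 'X_[_] _).
  apply/mnmP=> j; rewrite mnmDE mulmnE !mnmE -uE -bv !ffunE ffunMnE.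
  rewrite -mulr_natr natz addrC modzMDl modz_nat absz_nat addnC.
  exact: divn_eq.
case=> s sgr ->; exists (size s), (fun i => (nth (0, 0) s i).1%:MP * 'X_[deg_mod p u]).
exists (fun i => (nth (0, 0) s i).2), (fun=> multideg (deg_mod p u)), (fun=> deg_div p u).
split=> [i|].
  split; last exact: multideg_deg_mod.
    move=> b; rewrite mul_mpolyC => /msuppZ_le; rewrite msuppX inE => /eqP -> //.
  by apply: sgr; apply: mem_nth.
by rewrite (big_nth (0, 0)) big_mkord; apply: eq_bigr => i _; rewrite ftensor_scale.
Qed.

End FrobeniusComponent.

(** * The structure map and the multiplicities *)

Section StructureMap.
Variables (n p : nat) (A : comNzRingType).
Local Notation R := {mpoly A[n]}.

Lemma Frob_map_graded (M M' : lmodType R) gr gr' (f : {linear M -> M'}) :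
  (forall u x, gr u x -> gr' u (f x)) ->
  forall u t, @Frob_grading n A p M gr u t -> Frob_grading gr' u (Frob_map p f t).
Proof.
move=> fgr u t [k [r [m [v [w [h ->]]]]]]; exists k, r, (fun i => f (m i)), v, w.
split=> [i|]; first by have [rv mw e] := h i; split=> //; apply: fgr.
by rewrite raddf_sum; apply: eq_bigr => i _; apply: Frob_mapE.
Qed.

(** Homogeneous elements of [M] come from finite stages of the direct system,
whose maps preserve degrees.  For the converse, the finitely many elements in a
homogeneous tensor of [F(M)] are represented at one common stage, so the tensor is
the image under [theta] of an element of the next stage. *)
Lemma structure_map_graded (M : lmodType R) (theta : {linear M -> Frob p M}) gr :
  injective theta -> graded_F_finite theta gr ->
  forall u m, gr u m <-> Frob_grading gr u (theta m).
Proof.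
move=> theta_inj [V [grV [beta [phi [_ beta_gr [phi_f _] thetaE grE]]]]] u m.
have iter_gr e w x : Frob_iter_grading grV w x -> Frob_iter_grading grV w (Frob_iter_map beta e x).
  elim: e w x => [|e IH] w x /=; first exact: beta_gr.
  exact: Frob_map_graded.
have phi_gr e w x : Frob_iter_grading grV w x -> gr w (phi e x).
  by move=> wx; apply/grE; exists e, x.
split.
  move=> /grE[e [x [ux <-]]]; rewrite -phi_f thetaE.
  by apply: (Frob_map_graded (phi_gr e)); apply: (iter_gr e).
(* A representative at one stage can be moved to any later stage. *)
have lift_to e w x : Frob_iter_grading grV w x -> forall e', (e <= e')%N ->
    exists x', Frob_iter_grading grV w x' /\ phi e' x' = phi e x.
  move=> wx; elim=> [|e' IH]; first by rewrite leqn0 => /eqP e0; subst e; exists x.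
  rewrite leq_eqVlt => /orP[/eqP ee'|/IH[x' [wx' <-]]]; first by subst e; exists x.
  by exists (Frob_iter_map beta e' x'); split; [apply: iter_gr | apply: phi_f].
case=> k [r [x [v [w [h tE]]]]].
have /choice[e eE] : forall i, exists e, exists y,
    Frob_iter_grading grV (w i) y /\ phi e y = x i.
  by move=> i; have [_ /grE[e [y yE]] _] := h i; exists e, y.
pose e' := (\max_i e i)%N.
have /choice[y yE] : forall i, exists y, Frob_iter_grading grV (w i) y /\ phi e' y = x i.
  move=> i; have [y [wy <-]] := eE i; apply: lift_to wy _ _; exact: leq_bigmax.
pose t : Frob_iter p V e'.+1 := \sum_i ftensor p (r i) (y i).
have -> : m = phi e'.+1 t.
  apply: theta_inj; rewrite tE thetaE raddf_sum; apply: eq_bigr => i _.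
  by have [_ <-] := yE i; rewrite -Frob_mapE.
apply: phi_gr; exists k, r, y, v, w; split=> // i.
by have [rv _ uE] := h i; have [wy _] := yE i.
Qed.

End StructureMap.

Section Blocks.
Variables (n p : nat).
Hypothesis p1 : (1 < p)%N.

Lemma divz_nneg_bound (x : int) k : 0 <= x -> x <= k.+1%:Z -> 0 <= (x %/ p)%Z <= k%:Z.
Proof.
case: x => // x _; rewrite divz_nat !lez_nat /= => xk.
have [->|x0] := posnP x; first by rewrite div0n.
by rewrite -ltnS; apply: leq_trans xk; apply: ltn_Pdiv.
Qed.

Lemma divz_neg_bound (x : int) k : x <= -1 -> - k.+2%:Z <= x ->
  - k.+1%:Z <= (x %/ p)%Z <= -1.
Proof.
have p0 : 0 < p%:Z by rewrite ltz_nat ltnW.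
case: x => [x|x]; first by [].
move=> _; rewrite NegzE lerN2 lez_nat ltnS => xk; apply/andP; split.
  rewrite lez_divRL // mulNr lerN2 -PoszM lez_nat.
  apply: leq_trans (_ : k.+2 <= _)%N => //; rewrite (leq_trans _ (leq_mul (leqnn k.+1) p1)) //.
  by rewrite muln2 -addnn addSnnS leq_addl.
by rewrite -ltzD1 addNr ltz_divLR // mul0r oppr_lt0.
Qed.

Lemma block_constant (T : Type) (F : mdegree n -> T) :
  (forall u, F u = F (deg_div p u)) -> forall U : {set 'I_n}, constant_on (block U) F.
Proof.
move=> FE U; pose corner : mdegree n := [ffun i => if i \in U then 0 else -1].
(* A degree whose entries are within distance [k] of the corner gets strictly closer
   at each floor division by [p >= 2], until it is the corner. *)
have toc k : forall u : mdegree n,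
    (forall i, if i \in U then 0 <= u i <= k%:Z else - k.+1%:Z <= u i <= -1) ->
    F u = F corner.
  elim: k => [|k IH] u hu.
    congr F; apply/ffunP=> i; rewrite ffunE; have := hu i.
    by case: ifP => _ h; apply/eqP; rewrite eq_le ?h // andbC.
  rewrite FE; apply: IH => i; rewrite ffunE; have := hu i.
  by case: ifP => _ /andP[]; [apply: divz_nneg_bound | move=> h1 h2; apply: divz_neg_bound].
suff toC u : block U u -> F u = F corner by move=> u v /toC -> /toC ->.
move=> hu; apply: (toc (\sum_i `|u i|)%N) => i.
have le : `|u i| <= (\sum_i `|u i|)%N%:Z by rewrite -abszE lez_nat (bigD1 i) //= leq_addr.
have := hu i; case: ifP => _ h; rewrite h ?andbT /=.
  by apply: le_trans le; apply: ler_norm.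
rewrite lerNl; apply: le_trans (ler_norm _) _; rewrite normrN.
by apply: le_trans le _; rewrite lez_nat.
Qed.

End Blocks.

Lemma sum_mod_uniq (K : fieldType) (E : lmodType (fps K))
    (iota : {linear residue_mod K -> E}) (hE : injective_hull iota)
    (a b c a' b' c' : nat) (g : sum_mod E a b c -> sum_mod E a' b' c') :
  (forall k x y, g (k *: x + y) = k *: g x + g y) -> injective g ->
  (forall y, exists x, g x = y) -> [/\ a = a', b = b' & c = c'].
Proof.
move=> g_lin g_inj g_surj; have /choice[h gh] := g_surj.
have hg : cancel g h by move=> x; apply: g_inj; rewrite gh.
have h_lin k x y : h (k *: x + y) = k *: h x + h y.
  by apply: g_inj; rewrite g_lin !gh.
have h_inj : injective h := can_inj gh.
have h_surj x : exists y, h y = x by exists (g x).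
have aa : a = a' by apply/eqP; rewrite eqn_leq (socle_dim_leq hE g_lin) ?(socle_dim_leq hE h_lin).
have cc : c = c'.
  by apply/eqP; rewrite eqn_leq (cokernel_dim_leq hE g_lin) ?(cokernel_dim_leq hE h_lin).
split=> //; apply/eqP; rewrite -(eqn_add2r c) {2}cc eqn_leq.
by rewrite (rank_leq hE g_lin) ?(rank_leq hE h_lin).
Qed.

Lemma sum_mod_model (K : fieldType) (p : nat) (E : lmodType (fps K))
    (iota : {linear residue_mod K -> E}) (a b c : nat) :
  p \in [pchar K] -> injective_hull iota ->
  exists J : sum_mod E a b c -> sum_mod E a b c, frob_model p J.
Proof.
move=> hp hE; have [JE modE] := hull_model hp hE.
exact: ex_intro (frob_model_pair (frob_model_pair (frob_model_ffun 'I_a modE)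
  (frob_model_ffun 'I_b (fraction_model hp))) (frob_model_ffun 'I_c (regular_model hp))).
Qed.

(** The degree [u] part of [F(M)] is the Frobenius pullback over [A] of the
component of degree [floor (u / p)], hence isomorphic to any Frobenius model of
that component. *)
Lemma Frob_component_iso (n p : nat) (A : comNzRingType) (hp : p \in [pchar A])
    (M : lmodType {mpoly A[n]}) (gr : mdegree n -> M -> Prop) (u : mdegree n)
    (N : lmodType A) (J : N -> N) (f : N -> M) :
  is_grading gr -> frob_model p J ->
  (forall k x y, f (k *: x + y) = k%:MP_[n] *: f x + f y) -> injective f ->
  (forall m, gr (deg_div p u) m <-> exists x, f x = m) ->
  exists Phi : Frob p M -> N,
    [/\ forall k x y, Phi (k%:MP *: x + y) = k *: Phi x + Phi y,
        forall t, Frob_grading gr u t -> Phi t = 0 -> t = 0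
      & forall y, exists2 t, Frob_grading gr u t & Phi t = y].
Proof.
move=> grM [[JD JZ] J_span J_univ] f_lin f_inj f_im.
have p0 : (0 < p)%N := prime_gt0 (pcharf_prime hp).
have fD x y : f (x + y) = f x + f y by have := f_lin 1 x y; rewrite !scale1r.
have fZ k x : f (k *: x) = k%:MP *: f x.
  by have := f_lin k x 0; rewrite !addr0 (add_morph0 fD) addr0.
have [rho [rho_lin rhoK]] := component_retraction grM f_lin f_inj f_im.
have rhoD x y : rho (x + y) = rho x + rho y.
  by have := rho_lin 1 x y; rewrite !scale1r.
have rhoZ k x : rho (k%:MP *: x) = k *: rho x.
  by have := rho_lin k x 0; rewrite !addr0 (add_morph0 rhoD) addr0.
have JrhoD x y : J (rho (x + y)) = J (rho x) + J (rho y) by rewrite rhoD JD.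
have JrhoZ k x : J (rho (k%:MP *: x)) = k ^+ p *: J (rho x) by rewrite rhoZ JZ.
have [Phi [PhiD PhiZ PhiE]] := Frob_coordinate hp JrhoD JrhoZ (deg_mod p u).
have PhiJ y : Phi (ftensor p 'X_[deg_mod p u] (f y)) = J y.
  have mod_lt i : (deg_mod p u i < p)%N.
    by rewrite -ltz_nat deg_modE // ltz_pmod.
  have e_mod : mnm_mod p (deg_mod p u) = deg_mod p u.
    by apply/mnmP=> i; rewrite [LHS]mnmE modn_small.
  have e_div : mnm_div p (deg_mod p u) = 0%MM.
    by apply/mnmP=> i; rewrite [LHS]mnmE divn_small // mnmE.
  by rewrite PhiE e_mod e_div eqxx mpolyX0 scale1r rhoK.
have fD' x y : ftensor p 'X_[deg_mod p u] (f (x + y)) =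
    ftensor p 'X_[deg_mod p u] (f x) + ftensor p 'X_[deg_mod p u] (f y).
  by rewrite fD ftensor_addr.
have fZ' k x : ftensor p 'X_[deg_mod p u] (f (k *: x)) =
    k%:MP ^+ p *: ftensor p 'X_[deg_mod p u] (f x).
  by rewrite fZ -ftensor_bal mulrC ftensor_scale.
exists Phi; split=> [k x y|t|y]; first by rewrite PhiD PhiZ.
  move=> /(Frob_grading_component p0 grM)[s sgr ->].
  have [s' ->] : exists s' : seq (A * N), s = [seq (z.1, f z.2) | z <- s'].
    elim: s sgr => [|[k m] s IH] sgr; first by exists [::].
    have [|s' ->] := IH; first by move=> z zs; apply: sgr; rewrite inE zs orbT.
    have /f_im[x /= <-] := sgr (k, m) (mem_head _ _).
    by exists ((k, x) :: s').
  rewrite (add_morph_sum _ _ _ PhiD) !big_map /=.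
  under eq_bigr => z _ do rewrite PhiZ PhiJ.
  (* The semilinear map to test against is [x |-> X^alpha (x) f x]. *)
  exact: (J_univ _ (@mpolyC n A) _ _ fD' fZ').
have [s ->] := J_span y.
exists (\sum_(z <- s) z.1%:MP *: ftensor p 'X_[deg_mod p u] (f z.2)).
  apply/(Frob_grading_component p0 grM); exists [seq (z.1, f z.2) | z <- s].
    by move=> z /mapP[z' _ ->] /=; apply/f_im; exists z'.2.
  by rewrite big_map.
rewrite (add_morph_sum _ _ _ PhiD); apply: eq_bigr => z _.
by rewrite PhiZ PhiJ.
Qed.

(** Both decompositions describe [M_u]: one by assumption, the other through
[theta] and the pullback of the component of degree [floor (u / p)]. *)
Lemma multiplicities_deg_div (K : fieldType) (p : nat) (hp : p \in [pchar K]) (n : nat)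
    (M : lmodType {mpoly (fps K)[n]}) (theta : {linear M -> Frob p M})
    (gr : mdegree n -> M -> Prop) (E : lmodType (fps K))
    (iota : {linear residue_mod K -> E}) (a b c a' b' c' : nat) (u : mdegree n) :
  bijective theta -> is_grading gr -> graded_F_finite theta gr -> injective_hull iota ->
  component_iso (gr u) E a b c -> component_iso (gr (deg_div p u)) E a' b' c' ->
  [/\ a = a', b = b' & c = c'].
Proof.
move=> theta_bij grM hM hE [f [f_lin f_inj f_im]] [f' [f'_lin f'_inj f'_im]].
have theta_gr := structure_map_graded (bij_inj theta_bij) hM.
have [J modJ] := sum_mod_model a' b' c' hp hE.
have [Phi [Phi_lin Phi_inj Phi_surj]] :=
  Frob_component_iso (N := sum_mod E a' b' c') (pchar_fps hp) grM modJ f'_lin f'_inj f'_im.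
have f0 : f 0 = 0.
  have := f_lin 1 0 0; rewrite !scale1r addr0 => e.
  by apply: (addrI (f 0)); rewrite addr0 -e.
have PhiB x y : Phi (x - y) = Phi x - Phi y.
  by have := Phi_lin (-1) y x; rewrite rmorphN1 !scaleN1r ![- _ + _]addrC.
apply: (sum_mod_uniq (g := fun x : sum_mod E a b c => Phi (theta (f x))) hE).
- by move=> k x y; rewrite f_lin linearP Phi_lin.
- move=> x y /eqP; rewrite -subr_eq0 -PhiB -linearB.
  have -> : f x - f y = f (x - y).
    by have := f_lin (-1) y x; rewrite rmorphN1 !scaleN1r ![- _ + _]addrC.
  move=> /eqP /Phi_inj e; apply/eqP; rewrite -subr_eq0; apply/eqP/f_inj.
  rewrite f0; apply: (bij_inj theta_bij); rewrite linear0; apply: e.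
  by apply/theta_gr/f_im; exists (x - y).
- move=> y; have [t ut <-] := Phi_surj y; have [eta etaK thetaK] := theta_bij.
  have /f_im[x fx] : gr u (eta t) by apply/theta_gr; rewrite thetaK.
  by exists x; rewrite fx thetaK.
Qed.

Theorem theoremE (K : fieldType) (p : nat) (hp : p \in [pchar K]) (n : nat)
    (M : lmodType {mpoly (fps K)[n]})
    (theta : {linear M -> Frob p M}) (theta_iso : bijective theta)
    (gr : mdegree n -> M -> Prop) (grM : is_grading gr)
    (hM : graded_F_finite theta gr)
    (E : lmodType (fps K)) (iota : {linear residue_mod K -> E})
    (hE : injective_hull iota)
    (a b c : mdegree n -> nat)
    (habc : forall u, component_iso (gr u) E (a u) (b u) (c u)) :
  forall U : {set 'I_n},
    [/\ constant_on (block U) a, constant_on (block U) b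
      & constant_on (block U) c].
Proof.
have p1 := prime_gt1 (pcharf_prime hp).
have step u := multiplicities_deg_div hp theta_iso grM hM hE (habc u) (habc (deg_div p u)).
by move=> U; split; apply: (block_constant p1) => u; have [] := step u.
Qed.
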